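(* Let $(M,\varphi)$ be an $F$-crystal over $k$ of rank $2$ with Hodge slopes $0$ and $e>0$. Let $\lambda_1$ be the smallest Newton slope of $(M,\varphi)$. Then: (i) if $(M,\varphi)$ is a direct sum of two $F$-crystals of rank $1$, then $n_M=1$; (ii) if $(M,\varphi)$ is not a direct sum of two $F$-crystals of rank $1$ and is isoclinic, then $n_M=e$; (iii) if $(M,\varphi)$ is not a direct sum of two $F$-crystals of rank $1$ and is non-isoclinic, then $n_M\le 2\lambda_1$.
   Context: Let $p$ be a prime, $k$ an algebraically closed field of characteristic $p$, $W=W(k)$ its ring of Witt vectors, $K_0$ the fraction field of $W$, $\sigma$ the Frobenius automorphism of $W$ and $K_0$, and $W_n=W/(p^n)$. An $F$-crystal over $k$ is a pair $(M,\varphi)$ with $M$ a free $W$-module of finite rank $r\ge 1$ and $\varphi$ an injective $\sigma$-linear endomorphism of $M$. An isomorphism of $F$-crystals is a $W$-linear isomorphism commuting with the $\varphi$'s. Hodge slopes: the non-negative integers $e_1\le\dots\le e_r$ with $M/\varphi(M)\cong\bigoplus_{i=1}^r W_{e_i}$ as $W$-modules. Newton slopes: by Dieudonné–Manin, $(M\otimes_W K_0,\varphi)\cong\bigoplus_{\lambda\in\mathbb{Q}_{\ge0}}E_\lambda^{m_\lambda}$, where $E_\lambda$ is the simple $F$-isocrystal with all Newton slopes equal to $\lambda$; the Newton slopes of $(M,\varphi)$ are the $\lambda$ with $m_\lambda\ne0$, and $(M,\varphi)$ is isoclinic if there is only one such $\lambda$. Isomorphism number: $n_M$ is the smallest non-negative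 integer such that for every $g\in \mathrm{GL}(M)$ (the group of $W$-linear automorphisms of $M$) with $g\equiv 1 \bmod p^{n_M}$, the $F$-crystal $(M,g\varphi)$ is isomorphic to $(M,\varphi)$. It is known that such an integer exists. *)

(* Defs.v *)
From HB Require Import structures.
From mathcomp Require Import all_boot all_order all_algebra.
From mathcomp Require Import boolp finmap.
From mathcomp.multinomials Require Import monalg.

Set Implicit Arguments.
Unset Strict Implicit.
Unset Printing Implicit Defensive.

Import Order.TTheory GRing.Theory Num.Theory.

Local Open Scope ring_scope.

(* x = y modulo m R *)
Definition modeq (R : comNzRingType) (m : nat) (x y : R) : Prop :=
  exists z, x = y + z *+ m.

Section ModEq.
Variable R : comNzRingType.
Implicit Types (m : nat) (x y z : R).

Lemma modeq_refl m x : modeq m x x.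
Proof. by exists 0; rewrite mul0rn addr0. Qed.

Lemma modeq_sym m x y : modeq m x y -> modeq m y x.
Proof. by case=> z ->; exists (- z); rewrite mulNrn addrK. Qed.

Lemma modeq_trans m x y z : modeq m x y -> modeq m y z -> modeq m x z.
Proof. by case=> a -> [b ->]; exists (b + a); rewrite mulrnDl addrA. Qed.

Lemma modeqD m x y x' y' :
  modeq m x y -> modeq m x' y' -> modeq m (x + x') (y + y').
Proof. by case=> a -> [b ->]; exists (a + b); rewrite mulrnDl addrACA. Qed.

Lemma modeqN m x y : modeq m x y -> modeq m (- x) (- y).
Proof. by case=> a ->; exists (- a); rewrite mulNrn opprD. Qed.

Lemma modeqM m x y x' y' :
  modeq m x y -> modeq m x' y' -> modeq m (x * x') (y * y').
Proof.
case=> a -> [b ->]; exists (a * y' + y * b + a * b *+ m).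
rewrite mulrDl !mulrDr !(mulrnDl, mulrnAl, mulrnAr) -!addrA.
by congr (_ + _); rewrite [RHS]addrCA.
Qed.

Lemma modeqX m n x y : modeq m x y -> modeq m (x ^+ n) (y ^+ n).
Proof.
move=> h; elim: n => [|n IHn]; first exact: modeq_refl.
by rewrite !exprS; apply: modeqM.
Qed.

Lemma modeq_sum m n (F G : 'I_n -> R) :
  (forall i, modeq m (F i) (G i)) ->
  modeq m (\sum_(i < n) F i) (\sum_(i < n) G i).
Proof.
move=> h; elim/big_rec2: _ => [|i x y _ IH]; first exact: modeq_refl.
by apply: modeqD.
Qed.

Lemma modeqMn m n x y : modeq m x y -> modeq (m * n) (x *+ n) (y *+ n).
Proof. by case=> z ->; exists z; rewrite mulrnDl mulrnA. Qed.

Lemma modeq_dvd d m x y : (d %| m)%N -> modeq m x y -> modeq d x y.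
Proof.
by move=> /dvdnP[q ->] [z ->]; exists (z *+ q); rewrite -mulrnA.
Qed.

Lemma modeq0M m n x y : modeq m x 0 -> modeq n y 0 -> modeq (m * n) (x * y) 0.
Proof.
case=> a -> [b ->]; exists (a * b).
by rewrite !add0r mulrnAl mulrnAr -mulrnA mulnC.
Qed.

Lemma modeq0X m n x : modeq m x 0 -> modeq (m ^ n) (x ^+ n) 0.
Proof.
move=> h; elim: n => [|n IHn].
  by exists 1; rewrite add0r.
by rewrite exprS expnS; apply: modeq0M.
Qed.

Lemma modeq_exp_step p j x y :
  (0 < j)%N -> modeq (p ^ j) x y -> modeq (p ^ j.+1) (x ^+ p) (y ^+ p).
Proof.
move=> j0 xy; have xyp : modeq p x y.
  by apply: modeq_dvd xy; rewrite -{1}(expn1 p) dvdn_exp2l.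
suff: modeq (p ^ j.+1) (x ^+ p - y ^+ p) 0.
  by case=> z; rewrite add0r => Hz; exists z; rewrite -Hz addrC subrK.
rewrite subrXX expnSr; apply: modeq0M.
  by case: xy => z ->; exists z; rewrite add0r addrC addKr.
apply: (@modeq_trans _ _ (\sum_(i < p) y ^+ p.-1)).
  apply: modeq_sum => i; have -> : p.-1 = (p.-1 - i + i)%N.
    by rewrite subnK // -ltnS prednK //; case: (p) i => [[]|].
  rewrite exprD; apply: modeqM; last exact: modeq_refl.
  rewrite addnK -subn1 -subnDA add1n.
  exact: modeqX.
exists (y ^+ p.-1); by rewrite sumr_const card_ord add0r.
Qed.

Lemma modeq_exp p j x y :
  modeq p x y -> modeq (p ^ j.+1) (x ^+ (p ^ j)) (y ^+ (p ^ j)).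
Proof.
move=> xy; elim: j => [|j IHj]; first by rewrite expn0 !expr1 expn1.
by rewrite (expnSr p j) !exprM; apply: modeq_exp_step.
Qed.

End ModEq.

(* The n-th ghost component (Witt polynomial) of x. *)
HB.lock Definition ghost (p : nat) (R : comNzRingType) (n : nat) (x : nat -> R) : R :=
  \sum_(i < n.+1) x i ^+ (p ^ (n - i)) *+ p ^ i.

Lemma ghostE p (R : comNzRingType) n (x : nat -> R) :
  ghost p n x = \sum_(i < n.+1) x i ^+ (p ^ (n - i)) *+ p ^ i.
Proof. by rewrite unlock. Qed.

Lemma ghostS p (R : comNzRingType) n (x : nat -> R) :
  ghost p n x = \sum_(i < n) x i ^+ (p ^ (n - i)) *+ p ^ i + x n *+ p ^ n.
Proof. by rewrite ghostE big_ord_recr /= subnn expn0 expr1. Qed.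

Lemma eq_ghost p (R : comNzRingType) n (x y : nat -> R) :
  (forall i, (i <= n)%N -> x i = y i) -> ghost p n x = ghost p n y.
Proof. by move=> h; rewrite !ghostE; apply: eq_bigr => i _; rewrite h // -ltnS. Qed.

Lemma ghost_morph p (R S : comNzRingType) (f : {rmorphism R -> S}) n x :
  f (ghost p n x) = ghost p n (f \o x).
Proof.
rewrite !ghostE rmorph_sum; apply: eq_bigr => i _.
by rewrite rmorphMn rmorphXn.
Qed.

(* Z[X_(a, n)]: countably many families a of countably many variables. *)
Definition zpoly : comNzRingType := {malg int[{cmonom (nat * nat)%type}]}.

HB.lock Definition zvar (a n : nat) : zpoly :=
  (<< ucm (a, n) >> : {malg int[{cmonom (nat * nat)%type}]}).

Lemma zvarE a n : zvar a n = << ucm (a, n) >> :> {malg int[{cmonom (nat * nat)%type}]}.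
Proof. by rewrite unlock. Qed.

Section Eval.
Variables (R : comNzRingType) (v : nat -> nat -> R).

Definition monom_eval (m : {cmonom (nat * nat)%type}) : R :=
  \prod_(i <- finsupp m) v i.1 i.2 ^+ m i.

Lemma monom_evalEw (d : {fset nat * nat}) (m : {cmonom (nat * nat)%type}) : (finsupp m `<=` d)%fset ->
  monom_eval m = \prod_(i <- d) v i.1 i.2 ^+ m i.
Proof.
move=> le; rewrite /monom_eval (big_fset_incl _ le) //= => i _.
by rewrite -cmE_eq0 => /eqP ->; rewrite expr0.
Qed.

Lemma monom_eval_mmorphism : mmorphism monom_eval.
Proof.
split=> [m1 m2|]; last by rewrite /monom_eval mdom1 big_seq_fset0.
rewrite (@monom_evalEw (finsupp m1 `|` finsupp m2)%fset) ?mdomD //.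
rewrite (@monom_evalEw (finsupp m1 `|` finsupp m2)%fset m1) ?fsubsetUl //.
rewrite (@monom_evalEw (finsupp m1 `|` finsupp m2)%fset m2) ?fsubsetUr //.
by rewrite -big_split /=; apply: eq_bigr => i _; rewrite cmM exprD.
Qed.

HB.instance Definition _ :=
  isMultiplicative.Build _ _ monom_eval monom_eval_mmorphism.

End Eval.

HB.lock Definition zeval (R : comNzRingType) (v : nat -> nat -> R) (f : zpoly) : R :=
  mmap intr (monom_eval v) f.

Section EvalMorphism.
Variables (R : comNzRingType) (v : nat -> nat -> R).

Let zeval_def : zeval v = mmap intr (monom_eval v) :> (zpoly -> R).
Proof. by rewrite unlock. Qed.

Fact zeval_is_zmod_morphism : zmod_morphism (zeval v).
Proof. by move=> f g; rewrite zeval_def; apply: rmorphB. Qed.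

Fact zeval_is_monoid_morphism : monoid_morphism (zeval v).
Proof.
split; first by rewrite zeval_def; apply: rmorph1.
by move=> f g; rewrite zeval_def; apply: rmorphM.
Qed.

HB.instance Definition _ :=
  GRing.isZmodMorphism.Build zpoly R (zeval v) zeval_is_zmod_morphism.
HB.instance Definition _ :=
  GRing.isMonoidMorphism.Build zpoly R (zeval v) zeval_is_monoid_morphism.

Lemma zeval_var a n : zeval v (zvar a n) = v a n.
Proof.
rewrite zeval_def zvarE mmapU mul1r.
by rewrite /monom_eval mdomU big_seq_fset1 cmUU expr1.
Qed.

End EvalMorphism.

Lemma zeval_morph (R S : comNzRingType) (f : {rmorphism R -> S}) v s :
  f (zeval v s) = zeval (fun a n => f (v a n)) s.
Proof.
rewrite !unlock /mmap rmorph_sum; apply: eq_bigr => m _.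
rewrite rmorphM rmorph_int /monom_eval rmorph_prod; congr (_ * _).
by apply: eq_bigr => i _; rewrite rmorphXn.
Qed.

Lemma zpoly_mulrnI n (x y : zpoly) : (0 < n)%N -> x *+ n = y *+ n -> x = y.
Proof.
move=> n0 h; apply/malgP => m.
have := congr1 (mcoeff m) h; rewrite !mcoeffMn.
exact: pmulrnI.
Qed.

Lemma monom_evalU (R : comNzRingType) (v : nat -> nat -> R) i :
  monom_eval v (ucm i) = v i.1 i.2.
Proof. by rewrite /monom_eval mdomU big_seq_fset1 cmUU expr1. Qed.

Lemma malgUM (K : conomType) (a b : K) :
  << mmul a b >> = << a >> * << b >> :> {malg int[K]}.
Proof. by rewrite malgM_def fgmulUU mulr1. Qed.

Lemma malgUz (K : conomType) (k : K) (c : int) :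
  << c *g k >> = << k >> *~ c :> {malg int[K]}.
Proof.
case: c => n; first by rewrite -{1}[Posz n]natz monalgUMn.
by rewrite NegzE mulrNz monalgUN -{1}[Posz n.+1]natz monalgUMn.
Qed.

Lemma zpoly_monom (m : {cmonom (nat * nat)%type}) :
  (<< m >> : zpoly) = monom_eval zvar m.
Proof.
pose u (m : {cmonom (nat * nat)%type}) : zpoly := << m >>.
have u1 : u mone = 1 by [].
have uM : {morph u : a b / mmul a b >-> a * b}.
  by move=> a b; apply: malgUM.
pose w i := iter (m i) (mmul (ucm i)) mone.
have -> : m = \big[mmul/mone]_(i <- finsupp m) w i.
  apply/eqP/cmP => j.
  have wE i : w i j = (m i * (i == j))%N.
    rewrite /w; elim: (m i) => [|n IHn] /=; first by rewrite cm1.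
    by rewrite cmM IHn cmU mulSn.
  rewrite (big_morph (fun x : cmonom _ => x j) (fun a b => cmM j a b) (cm1 j)).
  under eq_bigr => i _ do rewrite wE.
  case: (boolP (j \in finsupp m)) => jm.
    rewrite (bigD1_seq j) ?fset_uniq //= eqxx muln1 big1 ?addn0 // => i /negPf ->.
    by rewrite muln0.
  have -> : m j = 0%N by apply/eqP; rewrite cmE_eq0.
  rewrite big_seq big1 // => i im; case: eqP => [ij|]; last by rewrite muln0.
  by rewrite -ij im in jm.
rewrite -/(u _) (big_morph u uM u1).
have [mM m1] := monom_eval_mmorphism zvar.
rewrite (big_morph (monom_eval zvar) mM m1).
apply: eq_bigr => -[a n] _; rewrite /w.
elim: (m _) => [|k IHk] /=; first by rewrite m1.
rewrite uM mM IHk; congr (_ * _).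
exact: etrans (esym (zvarE a n)) (esym (monom_evalU zvar (a, n))).
Qed.

Lemma modeq_exprD p (R : comNzRingType) (x y : R) : prime p ->
  modeq p ((x + y) ^+ p) (x ^+ p + y ^+ p).
Proof.
case: p => // p pr; rewrite exprDn big_ord_recr big_ord_recl /= subn0 subnn.
rewrite !expr0 mulr1 mul1r bin0 binn addrAC -[X in modeq _ _ X]addr0.
apply: modeqD; first exact: modeq_refl.
have {2}-> : (0 : R) = \sum_(i < p) 0 by rewrite big1.
apply: (@modeq_sum _ _ _ _ (fun _ => 0)) => i.
have /dvdnP[q ->] : (p.+1 %| 'C(p.+1, bump 0 i))%N.
  by apply: prime_dvd_bin => //; rewrite /bump /= add1n ltnS ltn_ord.
by rewrite mulrnA; eexists; rewrite add0r.
Qed.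

Section FrobeniusLift.
Variables (p : nat) (pr : prime p) (R : comNzRingType) (F : {rmorphism R -> R}).
Let P g := modeq p (F g) (g ^+ p).

Let p_gt0 : (0 < p)%N. Proof. exact: prime_gt0. Qed.

Lemma frob0 : P 0.
Proof. by rewrite /P rmorph0 expr0n eqn0Ngt p_gt0; apply: modeq_refl. Qed.

Lemma frobD g h : P g -> P h -> P (g + h).
Proof.
move=> Pg Ph; rewrite /P rmorphD; apply: modeq_trans (modeqD Pg Ph) _.
exact/modeq_sym/modeq_exprD.
Qed.

Lemma frobN g : P g -> P (- g).
Proof.
move=> Pg; rewrite /P rmorphN; apply: modeq_trans (modeqN Pg) _.
have := modeq_exprD g (- g) pr.
rewrite subrr expr0n eqn0Ngt p_gt0 /= => h.
have := modeqD (modeq_refl p (- g ^+ p)) h.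
by rewrite addr0 addKr.
Qed.

Lemma frobMn g n : P g -> P (g *+ n).
Proof.
move=> Pg; elim: n => [|n IHn]; first by rewrite mulr0n; apply: frob0.
by rewrite mulrS; apply: frobD.
Qed.

Lemma frobMz g z : P g -> P (g *~ z).
Proof.
move=> Pg; case: z => n; first exact: frobMn.
by rewrite NegzE mulrNz; apply/frobN/frobMn.
Qed.

End FrobeniusLift.

Definition zfrob p : {rmorphism zpoly -> zpoly} :=
  zeval (fun a n => zvar a n ^+ p).

Lemma zpoly_sum (f : zpoly) :
  f = \sum_(m <- msupp f) monom_eval zvar m *~ f@_m.
Proof.
rewrite [LHS]monalgE; apply: eq_bigr => m _.
by rewrite -zpoly_monom malgUz.
Qed.

Lemma zfrobP p f : prime p -> modeq p (zfrob p f) (f ^+ p).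
Proof.
move=> pr; rewrite (zpoly_sum f).
elim/big_ind: _ => [|g h|m _]; [exact: frob0 | exact: frobD | apply: frobMz => //].
rewrite /monom_eval rmorph_prod -prodrXl.
rewrite (eq_bigr (fun i => (zvar i.1 i.2 ^+ m i) ^+ p)) => [|i _].
  exact: modeq_refl.
by rewrite rmorphXn /zfrob /= zeval_var -!exprM mulnC.
Qed.

Section Dwork.
Variables (p : nat) (R : comNzRingType) (F : {rmorphism R -> R}).
Hypothesis FP : forall g, modeq p (F g) (g ^+ p).

Lemma ghost_frob n (x : nat -> R) :
  modeq (p ^ n.+1) (\sum_(i < n.+1) x i ^+ (p ^ (n.+1 - i)) *+ p ^ i)
        (F (ghost p n x)).
Proof.
rewrite ghostE rmorph_sum; apply: modeq_sum => i.
rewrite rmorphMn rmorphXn /=.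
have le_i_n : (i <= n)%N by rewrite -ltnS.
have -> : (p ^ n.+1 = p ^ (n - i).+1 * p ^ i)%N by rewrite -expnD addSn subnK.
rewrite subSn // [X in _ ^+ X]expnS exprM.
by apply/modeqMn/modeq_exp/modeq_sym.
Qed.

Definition divides_frob (a : nat -> R) : Prop :=
  forall n, modeq (p ^ n.+1) (a n.+1) (F (a n)).

Lemma divides_ghost x : divides_frob (fun n => ghost p n x).
Proof.
move=> n; apply: modeq_trans (ghost_frob n x); rewrite ghostS.
by exists (x n.+1).
Qed.

Lemma divides_frobD a b : divides_frob a -> divides_frob b ->
  divides_frob (fun n => a n + b n).
Proof. by move=> ha hb n; rewrite rmorphD; apply: modeqD. Qed.

Lemma divides_frobM a b : divides_frob a -> divides_frob b ->
  divides_frob (fun n => a n * b n).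
Proof. by move=> ha hb n; rewrite rmorphM; apply: modeqM. Qed.

Lemma divides_frobN a : divides_frob a -> divides_frob (fun n => - a n).
Proof. by move=> ha n; rewrite rmorphN; apply: modeqN. Qed.

Let dv m (f : R) : R :=
  if pselect (exists z, f = z *+ m) is left h then projT1 (cid h) else 0.

Let dvP m f : (exists z, f = z *+ m) -> dv m f *+ m = f.
Proof. by rewrite /dv; case: pselect => // h _; case: cid. Qed.

Fixpoint dwork_prefix (a : nat -> R) n : seq R :=
  if n is m.+1 then
    let s := dwork_prefix a m in
    rcons s (dv (p ^ m) (a m - \sum_(i < m) s`_i ^+ (p ^ (m - i)) *+ p ^ i))
  else [::].

Lemma dwork a : divides_frob a -> exists s, forall n, ghost p n s = a n.
Proof.
move=> ha; pose s i := (dwork_prefix a i.+1)`_i.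
have szE n : size (dwork_prefix a n) = n.
  by elim: n => //= n IHn; rewrite size_rcons IHn.
have sE n i : (i < n)%N -> (dwork_prefix a n)`_i = s i.
  elim: n => // n IHn; rewrite ltnS leq_eqVlt => /orP[/eqP -> //|lt_i_n].
  by rewrite /= nth_rcons szE lt_i_n IHn.
have s_rec n : s n =
    dv (p ^ n) (a n - \sum_(i < n) s i ^+ (p ^ (n - i)) *+ p ^ i).
  rewrite /s /= nth_rcons szE ltnn eqxx; congr (dv _ (_ - _)).
  by apply: eq_bigr => i _; rewrite sE.
exists s; elim=> [|n IHn]; rewrite ghostS s_rec dvP ?[RHS]addrC ?subrK ?subrKC //.
- by rewrite big_ord0 subr0; exists (a 0).
- have [z Hz] : modeq (p ^ n.+1) (a n.+1)
      (\sum_(i < n.+1) s i ^+ (p ^ (n.+1 - i)) *+ p ^ i).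
    apply: modeq_trans (ha n) _; rewrite -IHn.
    exact/modeq_sym/ghost_frob.
  by exists z; rewrite Hz addrC addKr.
Qed.

End Dwork.

Section TorsionFree.
Variables (p : nat) (pr : prime p) (R : comNzRingType).
Hypothesis torsion_free :
  forall n (x y : R), (0 < n)%N -> x *+ n = y *+ n -> x = y.

Let pX_gt0 n : (0 < p ^ n)%N. Proof. by rewrite expn_gt0 prime_gt0. Qed.

Lemma ghost_inj (x y : nat -> R) :
  (forall n, ghost p n x = ghost p n y) -> x =1 y.
Proof.
move=> h n; have [m] := ubnP n; elim: m n => // m IHm n /ltnSE le_n_m.
have := h n; rewrite !ghostS.
rewrite (eq_bigr (fun i : 'I_n => y i ^+ (p ^ (n - i)) *+ p ^ i)) => [|i _].
  by move/addrI; apply: torsion_free.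
by rewrite IHm // (leq_trans (ltn_ord i)).
Qed.

Lemma ghost_low a n (x : nat -> R) : (forall i, (i < a)%N -> x i = 0) ->
  (n < a)%N -> ghost p n x = 0.
Proof.
move=> x0 lt_n_a; rewrite ghostE; apply: big1 => i _; rewrite x0 ?expr0n.
  by rewrite expn_eq0 eqn0Ngt prime_gt0 // mul0rn.
by apply: leq_trans lt_n_a; apply: ltn_ord.
Qed.

Lemma ghost_lead a n (x : nat -> R) : (forall i, (i < a)%N -> x i = 0) ->
  (a <= n)%N ->
  exists z, ghost p n x = (x a ^+ (p ^ (n - a)) + z *+ p) *+ p ^ a.
Proof.
move=> x0 le_a_n.
suff: modeq (p ^ a.+1) (ghost p n x) (x a ^+ (p ^ (n - a)) *+ p ^ a).
  by case=> z ->; exists z; rewrite mulrnDl expnS mulrnA.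
have lt_a_n1 : (a < n.+1)%N by rewrite ltnS.
rewrite ghostE (bigD1 (Ordinal lt_a_n1)) //=.
rewrite -[X in modeq _ _ X]addr0; apply: modeqD; first exact: modeq_refl.
elim/big_rec: _ => [|i u ia IH]; first exact: modeq_refl.
rewrite -[X in modeq _ _ X]addr0; apply: modeqD IH; have [lt_i_a|] := ltnP i a.
  rewrite x0 // expr0n expn_eq0 eqn0Ngt prime_gt0 // mul0rn.
  exact: modeq_refl.
rewrite leq_eqVlt => /orP[/eqP ai|lt_a_i].
  by case/eqP: ia; apply: val_inj.
exists (x i ^+ (p ^ (n - i)) *+ p ^ (i - a.+1)).
by rewrite add0r -mulrnA -expnD subnK.
Qed.

Lemma lead_coord a (z : nat -> R) :
  (forall i, (i < a)%N -> modeq p (z i) 0) ->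
  modeq (p ^ a.+1) (ghost p a z) (z a *+ p ^ a).
Proof.
move=> z0; rewrite ghostS -[X in modeq _ _ X]add0r.
apply: modeqD; last exact: modeq_refl.
have E0 : \sum_(i < a) (0 : R) = 0 by rewrite big1.
rewrite -[X in modeq _ _ X]E0; apply: modeq_sum => i.
have -> : (p ^ a.+1 = p ^ (a - i).+1 * p ^ i)%N.
  by rewrite -expnD addSn subnK // ltnW.
rewrite -(mul0rn _ (p ^ i)); apply: modeqMn.
have := modeq_exp (a - i) (z0 i (ltn_ord i)).
by rewrite expr0n expn_eq0 eqn0Ngt prime_gt0.
Qed.

Lemma modeq_cancel n (x y : R) :
  modeq (p ^ n.+1) (x *+ p ^ n) (y *+ p ^ n) -> modeq p x y.
Proof.
case=> z; rewrite expnS mulrnA -mulrnDl => h.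
by exists z; apply: torsion_free h.
Qed.

Lemma ghost_mul_lead a b (x y z : nat -> R) :
  (forall i, (i < a)%N -> x i = 0) -> (forall i, (i < b)%N -> y i = 0) ->
  (forall n, ghost p n z = ghost p n x * ghost p n y) ->
  modeq p (z (a + b)) (x a ^+ (p ^ b) * y b ^+ (p ^ a)).
Proof.
move=> x0 y0 zE.
have ghost_z n : (a <= n)%N -> (b <= n)%N ->
    exists w, ghost p n z =
      (x a ^+ (p ^ (n - a)) * y b ^+ (p ^ (n - b)) + w *+ p) *+ p ^ (a + b).
  move=> an bn; rewrite zE; have [u ->] := ghost_lead x0 an.
  have [v ->] := ghost_lead y0 bn.
  set X := x a ^+ _; set Y := y b ^+ _.
  exists (u * Y + X * v + u * v *+ p).
  rewrite mulrnAl mulrnAr -mulrnA -expnD addnC; congr (_ *+ _).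
  rewrite mulrDl !mulrDr !(mulrnDl, mulrnAl, mulrnAr) -!addrA; congr (_ + _).
  by rewrite [LHS]addrCA.
have z_low i : (i < a + b)%N -> modeq p (z i) 0.
  have [m] := ubnP i; elim: m i => // m IHm i /ltnSE le_i_m lt_i.
  apply: (@modeq_cancel i); rewrite mul0rn.
  apply: modeq_trans (modeq_sym (lead_coord _)) _ => [j lt_j_i|].
    by apply: IHm; [apply: leq_trans le_i_m | apply: ltn_trans lt_i].
  have [lt_i_a|le_a_i] := ltnP i a.
    by rewrite zE (ghost_low x0) // mul0r; apply: modeq_refl.
  have [lt_i_b|le_b_i] := ltnP i b.
    by rewrite zE (ghost_low y0) // mulr0; apply: modeq_refl.
  have [w ->] := ghost_z i le_a_i le_b_i.
  apply: (modeq_dvd (dvdn_exp2l p lt_i)).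
  by eexists; rewrite add0r.
apply: (@modeq_cancel (a + b)).
apply: modeq_trans (modeq_sym (lead_coord z_low)) _.
have [w ->] := ghost_z _ (leq_addr b a) (leq_addl a b).
rewrite addKn addnK; exists w.
by rewrite mulrnDl expnS mulrnA.
Qed.

End TorsionFree.

Section WittPolynomials.
Variables (p : nat) (pr : prime p).

Local Notation X := (zvar 0).
Local Notation Y := (zvar 1).

Let dworkZ a := @dwork p zpoly (zfrob p) (fun g => zfrobP g pr) a.
Let dghost x := @divides_ghost p zpoly (zfrob p) (fun g => zfrobP g pr) x.

Lemma add_poly_exists : exists S : nat -> zpoly,
  forall n, ghost p n S = ghost p n X + ghost p n Y.
Proof. by apply: dworkZ; apply: divides_frobD; apply: dghost. Qed.

Lemma mul_poly_exists : exists P : nat -> zpoly,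
  forall n, ghost p n P = ghost p n X * ghost p n Y.
Proof. by apply: dworkZ; apply: divides_frobM; apply: dghost. Qed.

Lemma opp_poly_exists : exists N : nat -> zpoly,
  forall n, ghost p n N = - ghost p n X.
Proof. by apply: dworkZ; apply: divides_frobN; apply: dghost. Qed.

(* The integer polynomials S_n, P_n, I_n of Witt: the ghost equations determine
   them, since zpoly is torsion-free (ghost_inj). *)
Definition add_poly : nat -> zpoly := projT1 (cid add_poly_exists).
Definition mul_poly : nat -> zpoly := projT1 (cid mul_poly_exists).
Definition opp_poly : nat -> zpoly := projT1 (cid opp_poly_exists).

Section Operations.
Variable A : comNzRingType.
Implicit Types x y : nat -> A.

Definition subst2 x y (a : nat) : nat -> A := if a is 0 then x else y.

Definition wadd x y n : A := zeval (subst2 x y) (add_poly n).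
Definition wmul x y n : A := zeval (subst2 x y) (mul_poly n).
Definition wopp x n : A := zeval (subst2 x x) (opp_poly n).
Definition wzero (n : nat) : A := 0.
Definition wone (n : nat) : A := (n == 0)%:R.

Lemma ghost_zeval v (S : nat -> zpoly) n :
  ghost p n (fun i => zeval v (S i) : A) = zeval v (ghost p n S).
Proof. by rewrite ghost_morph. Qed.

Lemma zeval_ghost_var (v : nat -> nat -> A) a n :
  zeval v (ghost p n (zvar a)) = ghost p n (v a).
Proof.
by rewrite ghost_morph; apply: eq_ghost => i _; rewrite /comp /= zeval_var.
Qed.

Lemma ghost_wadd x y n : ghost p n (wadd x y) = ghost p n x + ghost p n y.
Proof.
rewrite ghost_zeval /add_poly; case: cid => S /= ->.
by rewrite rmorphD /= !zeval_ghost_var.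
Qed.

Lemma ghost_wmul x y n : ghost p n (wmul x y) = ghost p n x * ghost p n y.
Proof.
rewrite ghost_zeval /mul_poly; case: cid => S /= ->.
by rewrite rmorphM /= !zeval_ghost_var.
Qed.

Lemma ghost_wopp x n : ghost p n (wopp x) = - ghost p n x.
Proof.
rewrite ghost_zeval /opp_poly; case: cid => S /= ->.
by rewrite rmorphN /= !zeval_ghost_var.
Qed.

Lemma ghost_wzero n : ghost p n wzero = 0.
Proof.
rewrite ghostE; apply: big1 => i _.
by rewrite /wzero expr0n expn_eq0 eqn0Ngt prime_gt0 // mul0rn.
Qed.

Lemma ghost_wone n : ghost p n wone = 1.
Proof.
rewrite ghostE big_ord_recl /wone /= expr1n expn0 mulr1n big1 ?addr0 // => i _.
by rewrite /= expr0n expn_eq0 eqn0Ngt prime_gt0 // mul0rn.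
Qed.

End Operations.

Section Morphism.
Variables (A B : comNzRingType) (f : {rmorphism A -> B}).

Let subst2_morph x y : (fun a n => f (subst2 x y a n)) = subst2 (f \o x) (f \o y).
Proof. by apply/funext => -[|a]; apply/funext. Qed.

Lemma wadd_morph x y : f \o wadd x y = wadd (f \o x) (f \o y).
Proof. by apply/funext => n; rewrite /= zeval_morph subst2_morph. Qed.

Lemma wmul_morph x y : f \o wmul x y = wmul (f \o x) (f \o y).
Proof. by apply/funext => n; rewrite /= zeval_morph subst2_morph. Qed.

Lemma wopp_morph x : f \o wopp x = wopp (f \o x).
Proof. by apply/funext => n; rewrite /= zeval_morph subst2_morph. Qed.

Lemma wzero_morph : f \o @wzero A = @wzero B.
Proof. by apply/funext => n; apply: rmorph0. Qed.

Lemma wone_morph : f \o @wone A = @wone B.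
Proof. by apply/funext => n; apply: rmorph_nat. Qed.

End Morphism.

Section RingLaws.
Variable A : comNzRingType.
Implicit Types x y z : nat -> A.

Let lift x y z : exists f : {rmorphism zpoly -> A},
  [/\ x = f \o zvar 0, y = f \o zvar 1 & z = f \o zvar 2].
Proof.
exists (zeval (fun a => match a with 0 => x | 1 => y | _ => z end)).
by split; apply/funext => n; rewrite /comp /= zeval_var.
Qed.

Let zinj (x y : nat -> zpoly) : (forall n, ghost p n x = ghost p n y) -> x = y.
Proof.
by move=> h; apply/funext; apply: (ghost_inj pr zpoly_mulrnI).
Qed.

Lemma waddA : associative (@wadd A).
Proof.
move=> x y z; have [f [-> -> ->]] := lift x y z.
rewrite -!wadd_morph; congr (_ \o _); apply: zinj => n.
by rewrite !ghost_wadd addrA.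
Qed.

Lemma waddC : commutative (@wadd A).
Proof.
move=> x y; have [f [-> -> _]] := lift x y x.
rewrite -!wadd_morph; congr (_ \o _); apply: zinj => n.
by rewrite !ghost_wadd addrC.
Qed.

Lemma wadd0 : left_id (@wzero A) (@wadd A).
Proof.
move=> x; have [f [-> _ _]] := lift x x x.
rewrite -(wzero_morph f) -!wadd_morph; congr (_ \o _); apply: zinj => n.
by rewrite ghost_wadd ghost_wzero add0r.
Qed.

Lemma waddN : left_inverse (@wzero A) (@wopp A) (@wadd A).
Proof.
move=> x; have [f [-> _ _]] := lift x x x.
rewrite -(wzero_morph f) -wopp_morph -!wadd_morph.
congr (_ \o _); apply: zinj => n.
by rewrite ghost_wadd ghost_wzero ghost_wopp addNr.
Qed.

Lemma wmulA : associative (@wmul A).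
Proof.
move=> x y z; have [f [-> -> ->]] := lift x y z.
rewrite -!wmul_morph; congr (_ \o _); apply: zinj => n.
by rewrite !ghost_wmul mulrA.
Qed.

Lemma wmulC : commutative (@wmul A).
Proof.
move=> x y; have [f [-> -> _]] := lift x y x.
rewrite -!wmul_morph; congr (_ \o _); apply: zinj => n.
by rewrite !ghost_wmul mulrC.
Qed.

Lemma wmul1 : left_id (@wone A) (@wmul A).
Proof.
move=> x; have [f [-> _ _]] := lift x x x.
rewrite -(wone_morph f) -!wmul_morph; congr (_ \o _); apply: zinj => n.
by rewrite ghost_wmul ghost_wone mul1r.
Qed.

Lemma wmulD : left_distributive (@wmul A) (@wadd A).
Proof.
move=> x y z; have [f [-> -> ->]] := lift x y z.
rewrite -wadd_morph -!wmul_morph -wadd_morph; congr (_ \o _); apply: zinj => n.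
by rewrite ghost_wmul !ghost_wadd !ghost_wmul mulrDl.
Qed.

Lemma wmul_lead a b x y :
  p%:R = 0 :> A ->
  (forall i, (i < a)%N -> x i = 0) -> (forall i, (i < b)%N -> y i = 0) ->
  wmul x y (a + b) = x a ^+ (p ^ b) * y b ^+ (p ^ a).
Proof.
move=> p0 x0 y0.
pose X' i := if (i < a)%N then 0 else zvar 0 i.
pose Y' i := if (i < b)%N then 0 else zvar 1 i.
have [f [fX fY _]] := lift x y x.
have XE : f \o X' = x.
  apply/funext => i; rewrite /comp /X'; case: ifP => [ia|_].
    by rewrite rmorph0 x0.
  by rewrite [in RHS]fX.
have YE : f \o Y' = y.
  apply/funext => i; rewrite /comp /Y'; case: ifP => [ib|_].
    by rewrite rmorph0 y0.
  by rewrite [in RHS]fY.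
have [||w Hw] := @ghost_mul_lead p pr zpoly zpoly_mulrnI a b X' Y' (wmul X' Y') _ _
  (ghost_wmul X' Y').
- by move=> i ia; rewrite /X' ia.
- by move=> i ib; rewrite /Y' ib.
rewrite -{1}XE -{1}YE -wmul_morph /comp Hw rmorphD rmorphMn rmorphM !rmorphXn.
rewrite -[f (X' a)]/((f \o X') a) -[f (Y' b)]/((f \o Y') b) XE YE.
by rewrite -[_ *+ p]mulr_natr p0 mulr0 addr0.
Qed.

End RingLaws.

End WittPolynomials.

(* The ring W(k) of p-typical Witt vectors of a field k of characteristic p. *)
Record witt (k : fieldType) (p : nat) (hp : p \in [pchar k]) : Type :=
  Witt { wcoord : nat -> k }.

Section WittRing.
Variables (k : fieldType) (p : nat) (hp : p \in [pchar k]).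
Local Notation W := (witt hp).
Let pr : prime p := pcharf_prime hp.

HB.instance Definition _ := gen_eqMixin W.
HB.instance Definition _ := gen_choiceMixin W.

Lemma wcoord_inj : injective (@wcoord k p hp).
Proof. by case=> x [y] /= ->. Qed.

Definition witt_zero : W := Witt hp (@wzero k).
Definition witt_one : W := Witt hp (@wone k).
Definition witt_opp (x : W) : W := Witt hp (wopp pr (wcoord x)).
Definition witt_add (x y : W) : W := Witt hp (wadd pr (wcoord x) (wcoord y)).
Definition witt_mul (x y : W) : W := Witt hp (wmul pr (wcoord x) (wcoord y)).

Fact witt_addA : associative witt_add.
Proof. by move=> x y z; apply: wcoord_inj; apply: waddA. Qed.
Fact witt_addC : commutative witt_add.
Proof. by move=> x y; apply: wcoord_inj; apply: waddC. Qed.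
Fact witt_add0 : left_id witt_zero witt_add.
Proof. by move=> x; apply: wcoord_inj; apply: wadd0. Qed.
Fact witt_addN : left_inverse witt_zero witt_opp witt_add.
Proof. by move=> x; apply: wcoord_inj; apply: waddN. Qed.

HB.instance Definition _ :=
  GRing.isZmodule.Build W witt_addA witt_addC witt_add0 witt_addN.

Fact witt_mulA : associative witt_mul.
Proof. by move=> x y z; apply: wcoord_inj; apply: wmulA. Qed.
Fact witt_mulC : commutative witt_mul.
Proof. by move=> x y; apply: wcoord_inj; apply: wmulC. Qed.
Fact witt_mul1 : left_id witt_one witt_mul.
Proof. by move=> x; apply: wcoord_inj; apply: wmul1. Qed.
Fact witt_mulD : left_distributive witt_mul +%R.
Proof. by move=> x y z; apply: wcoord_inj; apply: wmulD. Qed.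
Fact witt_1neq0 : witt_one != 0.
Proof.
apply/eqP => /(congr1 (fun x : W => wcoord x 0)) /eqP.
by rewrite /= /wone /wzero eqxx oner_eq0.
Qed.

HB.instance Definition _ := GRing.Zmodule_isComNzRing.Build W
  witt_mulA witt_mulC witt_mul1 witt_mulD witt_1neq0.

Definition witt_unit : pred W := fun x => `[< exists y, y * x = 1 >].
Definition witt_inv (x : W) : W :=
  if pselect (exists y, y * x = 1) is left h then projT1 (cid h) else x.

Fact witt_mulVx : {in witt_unit, left_inverse 1 witt_inv *%R}.
Proof.
by move=> x /asboolP h; rewrite /witt_inv; case: pselect => // h'; case: cid.
Qed.
Fact witt_unitPl (x y : W) : y * x = 1 -> witt_unit x.
Proof. by move=> yx; apply/asboolP; exists y. Qed.
Fact witt_inv_out : {in [predC witt_unit], witt_inv =1 id}.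
Proof.
by move=> x /asboolPn h; rewrite /witt_inv; case: pselect.
Qed.

HB.instance Definition _ := GRing.ComNzRing_hasMulInverse.Build W
  witt_mulVx witt_unitPl witt_inv_out.

Fact witt_lead (x : W) : x != 0 ->
  exists a, wcoord x a != 0 /\ forall i, (i < a)%N -> wcoord x i = 0.
Proof.
move=> x0; have ex : exists a, wcoord x a != 0.
  apply: contrapT => h; case/eqP: x0; apply: wcoord_inj; apply/funext => i.
  by apply/eqP; apply: contrapT => /negP hi; apply: h; exists i.
exists (ex_minn ex); case: ex_minnP => a xa mina; split=> // i lt_i_a.
by apply/eqP; apply: contraTT lt_i_a => /mina; rewrite -leqNgt.
Qed.

Fact witt_integral (x y : W) : x * y = 0 -> (x == 0) || (y == 0).
Proof.
move=> xy0; rewrite -[_ || _]negbK negb_or; apply/negP => /andP[].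
move=> /witt_lead[a [xa x0]] /witt_lead[b [yb y0]].
have := wmul_lead pr (pcharf0 hp) x0 y0.
rewrite -[wmul _ _ _]/(wcoord (x * y)) xy0 => /esym/eqP.
by rewrite mulf_eq0 !expf_eq0 (negPf xa) (negPf yb) !andbF.
Qed.

HB.instance Definition _ := GRing.ComUnitRing_isIntegral.Build W witt_integral.

(* The Frobenius sigma = W(x |-> x ^ p). *)
Definition witt_frob (x : W) : W := Witt hp (fun n => wcoord x n ^+ p).

Let frobE (x : W) : wcoord (witt_frob x) = pFrobenius_aut hp \o wcoord x.
Proof. by []. Qed.

Fact witt_frob_is_zmod_morphism : zmod_morphism witt_frob.
Proof.
have frobD : {morph witt_frob : x y / x + y}.
  by move=> x y; apply: wcoord_inj; rewrite frobE wadd_morph.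
have frob0 : witt_frob 0 = 0.
  by apply: wcoord_inj; rewrite frobE wzero_morph.
move=> x y; rewrite frobD; congr (_ + _); apply/eqP.
by rewrite -addr_eq0 -frobD addNr frob0.
Qed.

Fact witt_frob_is_monoid_morphism : monoid_morphism witt_frob.
Proof.
split=> [|x y]; apply: wcoord_inj; rewrite frobE.
  by rewrite wone_morph.
by rewrite wmul_morph.
Qed.

HB.instance Definition _ :=
  GRing.isZmodMorphism.Build W W witt_frob witt_frob_is_zmod_morphism.
HB.instance Definition _ :=
  GRing.isMonoidMorphism.Build W W witt_frob witt_frob_is_monoid_morphism.

End WittRing.

Import VectorInternalTheory.

Local Notation "x %:F" := (@FracField.tofrac _ x).

Lemma frac_repr (R : idomainType) (x : {fraction R}) :
  x = (frac (repr x)).1%:F / (frac (repr x)).2%:F.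
Proof.
have d0 := denom_ratioP (repr x).
apply: (canRL (mulfK _)); first by rewrite tofrac_eq0.
rewrite -{1}[x]reprK; set r := repr x in d0 *.
rewrite -[LHS]/(FracField.mul _ _) !piE; apply/eqmodP.
rewrite /= FracField.equivfE /FracField.mulf !numden_Ratio ?mulf_neq0 ?oner_eq0 //.
by rewrite !mulr1 mulrC.
Qed.

Section FCrystals.
Variables (k : fieldType) (p : nat) (hp : p \in [pchar k]).
Local Notation W := (witt hp).
Local Notation K0 := {fraction witt hp}.
Local Notation sigma := (@witt_frob k p hp).

(* The extension of sigma to K0. *)
Definition frac_frob (x : K0) : K0 :=
  (sigma (frac (repr x)).1)%:F / (sigma (frac (repr x)).2)%:F.

Let sigma_eq0 a : (sigma a == 0) = (a == 0).
Proof.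
apply/eqP/eqP => [h|->]; last by rewrite rmorph0.
apply: wcoord_inj; apply/funext => n; apply/eqP.
have /eqP := congr1 (fun x : W => wcoord x n) h.
by rewrite /= expf_eq0 => /andP[].
Qed.

Lemma frac_frobE (a b : W) : b != 0 ->
  frac_frob (a%:F / b%:F) = (sigma a)%:F / (sigma b)%:F.
Proof.
move=> b0; rewrite /frac_frob; set x := a%:F / b%:F.
have d0 := denom_ratioP (repr x).
have /eqP := frac_repr x; rewrite {1}/x.
set n := (frac (repr x)).1; set d := (frac (repr x)).2 in d0 *.
rewrite eqr_div ?tofrac_eq0 // -!tofracM tofrac_eq => /eqP h.
apply/eqP; rewrite eqr_div ?tofrac_eq0 ?sigma_eq0 // -!tofracM tofrac_eq.
by rewrite -!rmorphM h.
Qed.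

Fact frac_frob_is_zmod_morphism : zmod_morphism frac_frob.
Proof.
move=> x y; rewrite [x]frac_repr [y]frac_repr.
have := denom_ratioP (repr x); have := denom_ratioP (repr y).
move: (frac (repr x)).1 (frac (repr x)).2 (frac (repr y)).1 (frac (repr y)).2.
move=> a b c d d0 b0; rewrite -mulNr addf_div ?tofrac_eq0 // -tofracN -!tofracM -tofracD.
rewrite !frac_frobE ?mulf_neq0 // -mulNr addf_div ?tofrac_eq0 ?sigma_eq0 //.
by rewrite -tofracN -!tofracM -tofracD rmorphD !rmorphM rmorphN.
Qed.

Fact frac_frob_is_monoid_morphism : monoid_morphism frac_frob.
Proof.
split=> [|x y].
  by rewrite -[X in frac_frob X]divr1 -tofrac1 frac_frobE ?oner_eq0 // rmorph1 divff ?tofrac_eq0 ?oner_eq0.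
rewrite [x]frac_repr [y]frac_repr.
have := denom_ratioP (repr x); have := denom_ratioP (repr y).
move: (frac (repr x)).1 (frac (repr x)).2 (frac (repr y)).1 (frac (repr y)).2.
move=> a b c d d0 b0; rewrite mulf_div -!tofracM !frac_frobE ?mulf_neq0 //.
by rewrite mulf_div -!tofracM !rmorphM.
Qed.

HB.instance Definition _ :=
  GRing.isZmodMorphism.Build K0 K0 frac_frob frac_frob_is_zmod_morphism.
HB.instance Definition _ :=
  GRing.isMonoidMorphism.Build K0 K0 frac_frob frac_frob_is_monoid_morphism.

Definition fcrystal (M : vectType W) (phi : M -> M) : Prop :=
  [/\ (0 < dim M)%N,
      forall a u v, phi (a *: u + v) = sigma a *: phi u + phi v &
      injective phi].

Definition fcrystal_iso (M N : vectType W) (phi : M -> M) (psi : N -> N) : Prop :=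
  exists f : {linear M -> N}, bijective f /\ forall u, f (phi u) = psi (f u).

Definition fcrystal_sum (M N : vectType W) (phi : M -> M) (psi : N -> N) :
    (M * N)%type -> (M * N)%type :=
  fun u => (phi u.1, psi u.2).

Definition sum_of_two_rank1 (M : vectType W) (phi : M -> M) : Prop :=
  exists (M1 M2 : vectType W) (phi1 : M1 -> M1) (phi2 : M2 -> M2),
    [/\ fcrystal phi1 /\ dim M1 = 1%N, fcrystal phi2 /\ dim M2 = 1%N &
        fcrystal_iso phi (fcrystal_sum phi1 phi2)].

(* M / phi(M) is isomorphic to the direct sum of the W / p^(es_i): f picks
   representatives of the images under the isomorphism. *)
Definition hodge_slopes (M : vectType W) (phi : M -> M) (es : seq nat) : Prop :=
  [/\ size es = dim M, sorted leq es &
    exists f : M -> 'rV[W]_(size es),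
    [/\ forall a u v (i : 'I_(size es)), modeq (p ^ nth 0 es i) (f (a *: u + v) 0 i)
                                          (a * f u 0 i + f v 0 i),
        forall u, (forall i : 'I_(size es), modeq (p ^ nth 0 es i) (f u 0 i) 0) <->
                  (exists v, u = phi v) &
        forall y : 'rV[W]_(size es),
          exists u, forall i : 'I_(size es), modeq (p ^ nth 0 es i) (f u 0 i) (y 0 i)]].

Definition isomorphism_bound (M : vectType W) (phi : M -> M) (n : nat) : Prop :=
  forall g : {linear M -> M}, bijective g ->
    (forall u, exists w, g u = u + w *+ p ^ n) ->
    fcrystal_iso (g \o phi) phi.

Definition isomorphism_number (M : vectType W) (phi : M -> M) (n : nat) : Prop :=
  isomorphism_bound phi n /\ forall m, isomorphism_bound phi m -> (n <= m)%N.

(* The F-isocrystal K0^n with v |-> sigma(v) A, on row vectors. *)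
Definition isocrystal n (A : 'M[K0]_n) (v : 'rV[K0]_n) : 'rV[K0]_n :=
  map_mx frac_frob v *m A.

Definition isocrystal_iso m n (A : 'M[K0]_m) (B : 'M[K0]_n) : Prop :=
  exists f : {linear 'rV[K0]_m -> 'rV[K0]_n},
    bijective f /\ forall v, f (isocrystal A v) = isocrystal B (f v).

(* M (x) K0 in the canonical basis of M. *)
Definition frob_mx (M : vectType W) (phi : M -> M) : 'M[K0]_(dim M) :=
  \matrix_(i, j) (v2r (phi (r2v (delta_mx 0 i))) 0 j)%:F.

(* E_l for l = s / r in lowest terms: basis e_0, ..., e_(r - 1) with
   e_i |-> e_(i + 1) for i < r - 1 and e_(r - 1) |-> p^s e_0. *)
Definition simple_mx (l : rat) : 'M[K0]_(`|denq l|%N) :=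
  \matrix_(i, j) if i.+1 == `|denq l|%N then (p%:R ^+ `|numq l|) *+ (j == 0 :> nat)
                 else (j == i.+1 :> nat)%:R.

Definition newton_decomposition (M : vectType W) (phi : M -> M) m
    (l : 'I_m -> rat) : Prop :=
  (forall i, 0 <= l i) /\
  isocrystal_iso (frob_mx phi) (\mxdiag_(i < m) simple_mx (l i)).

Definition newton_slope (M : vectType W) (phi : M -> M) (l : rat) : Prop :=
  exists m (ls : 'I_m -> rat),
    newton_decomposition phi ls /\ exists i, ls i = l.

Definition isoclinic (M : vectType W) (phi : M -> M) : Prop :=
  exists! l, newton_slope phi l.

Definition smallest_newton_slope (M : vectType W) (phi : M -> M) (l : rat) : Prop :=
  newton_slope phi l /\ forall l', newton_slope phi l' -> l <= l'.

End FCrystals.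

(* Main.v *)
From HB Require Import structures.
Require Import Defs.
From mathcomp Require Import all_boot all_order all_algebra.
From mathcomp Require Import boolp ring zify.

(* Choose bases (e1, e2), (v1, v2) of M with phi e1 = v1 and phi e2 = p^e v2, and write
   v1 = a e1 + c e2.

   If a is a unit, then phi is not nilpotent modulo p, and phi is isomorphic to diag(1, p^e);
   this applies to every g phi with g = 1 mod p. This is exactly the decomposable case.

   Otherwise e1 and phi e1 form a basis, in which phi^2 e1 = p^e u e1 + beta phi e1 with u a unit
   and p | beta. For g = 1 mod p^n the pair (u, beta) changes by a multiple of p^n, and two such
   pairs give isomorphic crystals if and only if an explicit sigma-linear system in two unknowns
   a, b, with a a unit, is solvable. An additive endomorphism of W^2 that is surjective modulo p
   is surjective, so the system can be solved if its reduction, a system of additive polynomial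
   equations over k, can be solved. This proves the upper bound e if p^(e/2) | beta, and 2 w if
   beta = p^w * unit with 2 w < e. If p^(e/2) | beta, then replacing beta by beta + p^(e-1) s for
   a suitable s makes the system insoluble, so that the upper bound e is sharp.

   A Newton slope s / r yields v <> 0 in M with phi^r v = p^s v. Comparing the growth of the
   coordinates of phi^n v with this equation shows that every slope is e / 2 if p^(e/2) | beta,
   and that if beta = p^w * unit with 2 w < e, then every slope is at least w and the crystal is
   not isoclinic. *)

Set Implicit Arguments.
Unset Strict Implicit.
Unset Printing Implicit Defensive.

Import Order.TTheory GRing.Theory Num.Theory VectorInternalTheory.

Local Open Scope ring_scope.

(** * Witt vectors of an algebraically closed field *)

Section WittCoordinates.
Variables (p : nat) (pr : prime p).

(** The Verschiebung V. *)
Definition wshift (A : comNzRingType) (x : nat -> A) (n : nat) : A :=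
  if n is m.+1 then x m else 0.

(** Defined over every ring, so that identities can be proved over the torsion-free ring [zpoly],
    where ghost components are faithful, and then specialised. *)
Definition wmuln (A : comNzRingType) (x : nat -> A) (n : nat) : nat -> A :=
  iter n (wadd pr x) (@wzero A).

Lemma ghost_wshift (A : comNzRingType) (x : nat -> A) n :
  ghost p n.+1 (wshift x) = ghost p n x *+ p.
Proof.
rewrite !ghostE big_ord_recl /= expr0n expn_eq0 eqn0Ngt prime_gt0 // mul0rn add0r.
rewrite -sumrMnl; apply: eq_bigr => i _.
by rewrite /bump /= add1n subSS expnS -mulrnA mulnC.
Qed.

Lemma ghost_wmuln (A : comNzRingType) (x : nat -> A) n m :
  ghost p m (wmuln x n) = ghost p m x *+ n.
Proof.
elim: n => [|n IHn]; first by rewrite ghost_wzero.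
by rewrite /wmuln iterS ghost_wadd -/(wmuln _ _) IHn mulrS.
Qed.

Lemma wmuln_morph (A B : comNzRingType) (f : {rmorphism A -> B}) x n :
  f \o wmuln x n = wmuln (f \o x) n.
Proof.
elim: n => [|n IHn]; first exact: wzero_morph.
by rewrite /wmuln !iterS -!/(wmuln _ _) wadd_morph IHn.
Qed.

Lemma modeq_addlI (A : comNzRingType) m (a b c d : A) :
  modeq m (a + b) (c + d) -> modeq m a c -> modeq m b d.
Proof.
move=> h1 h2; have {}h1 := modeqD h1 (modeqN h2).
by rewrite [a + b - a]addrAC [c + d - c]addrAC !subrr !add0r in h1.
Qed.

Section TorsionFree.
Variable R : comNzRingType.
Hypothesis torsion_free :
  forall n (x y : R), (0 < n)%N -> x *+ n = y *+ n -> x = y.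

(** Induction on n: a congruence of x_i and y_i modulo p becomes one modulo p^(n-i+1) between their
    p^(n-i)-th powers, so the terms below n agree modulo p^(n+1), and p^n can be cancelled from the
    last one. *)
Lemma ghost_modeq_inj (x y : nat -> R) :
  (forall n, modeq (p ^ n.+1) (ghost p n x) (ghost p n y)) ->
  forall n, modeq p (x n) (y n).
Proof.
move=> h n; have [m] := ubnP n; elim: m n => // m IHm n /ltnSE le_n_m.
apply: (modeq_cancel pr torsion_free (n := n)).
have := h n; rewrite !ghostS => hn.
have hs : modeq (p ^ n.+1) (\sum_(i < n) x i ^+ (p ^ (n - i)) *+ p ^ i)
            (\sum_(i < n) y i ^+ (p ^ (n - i)) *+ p ^ i).
  apply: modeq_sum => i.
  have -> : (p ^ n.+1 = p ^ (n - i).+1 * p ^ i)%N.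
    by rewrite -expnD addSn subnK // ltnW.
  apply: modeqMn; apply: modeq_exp; apply: IHm.
  exact: leq_trans (ltn_ord i) _.
exact: modeq_addlI hn hs.
Qed.

Lemma eq_ghost_coord n (x y : nat -> R) :
  (forall i, (i < n)%N -> ghost p i x = ghost p i y) ->
  forall i, (i < n)%N -> x i = y i.
Proof.
move=> h i; have [m] := ubnP i; elim: m i => // m IHm i /ltnSE le_i_m lt_i_n.
have := h i lt_i_n; rewrite !ghostS.
rewrite (eq_bigr (fun j : 'I_i => y j ^+ (p ^ (i - j)) *+ p ^ j)) => [|j _].
  by move/addrI; apply: torsion_free; rewrite expn_gt0 prime_gt0.
congr (_ ^+ _ *+ _); apply: IHm.
  exact: leq_trans (ltn_ord j) le_i_m.
exact: ltn_trans (ltn_ord j) lt_i_n.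
Qed.

(** The n-th ghost components of the two sides differ only by p^(n+1) x_n. *)
Lemma wmuln_wshift (x : nat -> R) n :
  modeq p (wmuln x p n) (wshift (fun i => x i ^+ p) n).
Proof.
move: n; apply: ghost_modeq_inj => n; rewrite ghost_wmuln.
case: n => [|n].
  rewrite !ghostE !big_ord1 /= expr1 mulr1n expr1; exists (x 0).
  by rewrite add0r expn1.
rewrite ghost_wshift ghostS mulrnDl -mulrnA -expnSr.
exists (x n.+1); congr (_ + _); rewrite ghostE; congr (_ *+ _).
by apply: eq_bigr => i _; rewrite -exprM -expnS subSn // -ltnS.
Qed.

End TorsionFree.

Lemma zvar_lift (A : comNzRingType) (x y z : nat -> A) :
  exists f : {rmorphism zpoly -> A},
  [/\ f \o zvar 0 = x, f \o zvar 1 = y & f \o zvar 2 = z].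
Proof.
exists (zeval (fun a => match a with 0 => x | 1 => y | _ => z end)).
by split; apply/funext => n; rewrite /comp /= zeval_var.
Qed.

(** Checked on generic sequences over [zpoly], where the ghost components below n determine the
    coordinates below n. *)
Lemma wadd_local (A : comNzRingType) n (x x' y : nat -> A) :
  (forall i, (i < n)%N -> x i = x' i) ->
  forall i, (i < n)%N -> wadd pr x y i = wadd pr x' y i.
Proof.
move=> h i lt_i_n.
have [f [fx fx' fy]] := zvar_lift x x' y.
(* A generic sequence that agrees with [zvar 0] below n and still specialises to x'. *)
pose X' i := if (i < n)%N then zvar 0 i else zvar 1 i.
have fX' : f \o X' = x'.
  apply/funext => j; rewrite /comp /X'; case: ltnP => hj.
    by rewrite -h // -fx.
  by rewrite -fx'.
rewrite -fX' -fx -fy -!wadd_morph /comp; congr (f _).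
apply: (eq_ghost_coord zpoly_mulrnI (n := n)) lt_i_n => j lt_j_n.
rewrite !ghost_wadd; congr (_ + _); apply: eq_ghost => l le_l_j.
by rewrite /X' (leq_ltn_trans le_l_j).
Qed.

Lemma wmuln_p (A : comNzRingType) (x : nat -> A) : p%:R = 0 :> A ->
  wmuln x p = wshift (fun i => x i ^+ p).
Proof.
move=> p0; have [f [fx _ _]] := zvar_lift x x x.
rewrite -fx -wmuln_morph; apply/funext => n.
have [z hz] := wmuln_wshift zpoly_mulrnI (zvar 0) n.
rewrite [LHS](congr1 f hz) rmorphD rmorphMn -mulr_natr p0 mulr0 addr0.
by case: n {hz} => [|n] /=; rewrite ?rmorph0 ?rmorphXn.
Qed.

End WittCoordinates.

(** * Multiplication by p and congruences in Witt coordinates *)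

Section WittArithmetic.
Variables (k : closedFieldType) (p : nat) (hp : p \in [pchar k]).
Local Notation W := (witt hp).
Local Notation sigma := (@witt_frob k p hp).
Let pr : prime p := pcharf_prime hp.

Lemma root_exists (n : nat) (c : k) : (0 < n)%N -> exists x, x ^+ n = c.
Proof.
move=> n0; have [x hx] := solve_monicpoly (fun i => if i == 0%N then c else 0) n0.
exists x; rewrite hx; case: n n0 {hx} => // n _.
by rewrite big_ord_recl /= expr0 mulr1 big1 ?addr0 // => i _; rewrite mul0r.
Qed.

Lemma wcoordD (x y : W) : wcoord (x + y) = wadd pr (wcoord x) (wcoord y).
Proof. by []. Qed.

Lemma wcoordMp (x : W) : wcoord (x *+ p) = wshift (fun i => wcoord x i ^+ p).
Proof.
rewrite -(wmuln_p pr _ (pcharf0 hp)).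
have E n : wcoord (x *+ n) = wmuln pr (wcoord x) n.
  by elim: n => [|n IHn] //; rewrite mulrS /wmuln iterS -/(wmuln _ _ _) -IHn.
exact: E.
Qed.

Lemma witt_frob_bij : bijective sigma.
Proof.
have ex (x : W) : exists y, sigma y = x.
  have [r hr] := choice (fun c : k => root_exists c (prime_gt0 pr)).
  by exists (Witt hp (r \o wcoord x)); apply: wcoord_inj; apply/funext => i /=; rewrite hr.
have [s hs] := choice ex.
exists s => x //; apply: wcoord_inj; apply/funext => i.
have /(congr1 (fun y : W => wcoord y i)) /= := hs (sigma x).
exact: (fmorph_inj (pFrobenius_aut hp)).
Qed.

(** Multiplication by p is V after the Frobenius, which is bijective, so p^n W = V^n W. *)
Lemma wcoord_dvd (x : W) n :
  (exists y, x = y *+ p ^ n) <-> (forall i, (i < n)%N -> wcoord x i = 0).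
Proof.
elim: n x => [|n IHn] x; first by split=> // _; exists x.
split=> [[y ->] i|h].
  rewrite expnSr mulrnA wcoordMp; case: i => //= i lt_i_n.
  have /IHn -> // : exists z, y *+ p ^ n = z *+ p ^ n by exists y.
  by rewrite expr0n eqn0Ngt prime_gt0.
have [y hy] : exists y, x = y *+ p.
  have [s _ hs] := witt_frob_bij.
  exists (s (Witt hp (fun i => wcoord x i.+1))); apply: wcoord_inj; rewrite wcoordMp.
  apply/funext => -[|i]; first by rewrite h.
  by have /(congr1 (fun y : W => wcoord y i)) /= -> := hs (Witt hp (fun i => wcoord x i.+1)).
have /IHn [z hz] : forall i, (i < n)%N -> wcoord y i = 0.
  move=> i lt_i_n; have := h i.+1 lt_i_n; rewrite hy wcoordMp /= => /eqP.
  by rewrite expf_eq0 => /andP[_ /eqP].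
by exists z; rewrite expnSr mulrnA -hz.
Qed.

Lemma wcoord_modeq (x y : W) n :
  modeq (p ^ n) x y <-> (forall i, (i < n)%N -> wcoord x i = wcoord y i).
Proof.
split=> [[z ->] i lt_i_n|h].
  rewrite addrC -[RHS](_ : wcoord (0 + y) i = _); last by rewrite add0r.
  rewrite !wcoordD; apply: (wadd_local pr (n := n)) lt_i_n => j lt_j_n.
  by have /wcoord_dvd -> // : exists u, z *+ p ^ n = u *+ p ^ n; exists z.
have /wcoord_dvd [z hz] : forall i, (i < n)%N -> wcoord (x - y) i = 0.
  move=> i lt_i_n; rewrite -[RHS](_ : wcoord (y - y) i = _); last by rewrite subrr.
  by rewrite !wcoordD; apply: (wadd_local pr (n := n)) lt_i_n.
by exists z; rewrite -hz addrC subrK.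
Qed.

Lemma wcoord0D (x y : W) : wcoord (x + y) 0 = wcoord x 0 + wcoord y 0.
Proof.
have := ghost_wadd pr (wcoord x) (wcoord y) 0.
by rewrite !ghostE !big_ord1 /= !expr1.
Qed.

Lemma wcoord0M (x y : W) : wcoord (x * y) 0 = wcoord x 0 * wcoord y 0.
Proof.
have := ghost_wmul pr (wcoord x) (wcoord y) 0.
by rewrite !ghostE !big_ord1 /= !expr1.
Qed.

Definition residue (x : W) : k := wcoord x 0.

Fact residue_is_zmod_morphism : zmod_morphism residue.
Proof.
have r0 : residue 0 = 0 by [].
move=> x y; rewrite /residue wcoord0D; congr (_ + _); apply/eqP.
by rewrite -addr_eq0 -wcoord0D addNr.
Qed.

Fact residue_is_monoid_morphism : monoid_morphism residue.
Proof. by split=> [|x y]; [|apply: wcoord0M]. Qed.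

HB.instance Definition _ :=
  GRing.isZmodMorphism.Build W k residue residue_is_zmod_morphism.
HB.instance Definition _ :=
  GRing.isMonoidMorphism.Build W k residue residue_is_monoid_morphism.

Lemma residue_surj (c : k) : exists x, residue x = c.
Proof. by exists (Witt hp (fun=> c)). Qed.

Lemma residue_frob (x : W) : residue (sigma x) = residue x ^+ p.
Proof. by []. Qed.

Lemma residue_eq0 (x : W) : (residue x = 0) <-> (exists y, x = p%:R * y).
Proof.
have := wcoord_dvd x 1; rewrite expn1 => -[h1 h2]; split.
  by move=> h; case: h2 => [[]//|y ->]; exists y; rewrite mulr_natl.
by case=> y hy; apply: h1 => //; exists y; rewrite hy mulr_natl.
Qed.

End WittArithmetic.

Arguments residue : simpl never.
Arguments witt_frob : simpl never.

(** * Successive approximation in p-adically complete groups *)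

Section Complete.
Variable p : nat.

(** Convergence of all series with terms s_i p^i, phrased by congruences with the partial sums
    instead of a topology. *)
Definition p_complete (V : zmodType) : Prop :=
  forall s : nat -> V, exists t, forall n, exists z,
    t = \sum_(i < n) s i *+ p ^ i + z *+ p ^ n.

Definition p_separated (V : zmodType) : Prop :=
  forall x : V, (forall n, exists z, x = z *+ p ^ n) -> x = 0.

Lemma p_complete_prod (U V : zmodType) :
  p_complete U -> p_complete V -> p_complete (U * V)%type.
Proof.
move=> cU cV s; have [t ht] := cU (fun i => (s i).1); have [u hu] := cV (fun i => (s i).2).
exists (t, u) => n; have [y hy] := ht n; have [z hz] := hu n; exists (y, z).
rewrite [RHS]surjective_pairing; congr (_, _).
  rewrite (raddfD fst) (raddf_sum fst) (raddfMn fst) /= hy; congr (_ + _).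
  by apply: eq_bigr => i _; rewrite (raddfMn fst).
rewrite (raddfD snd) (raddf_sum snd) (raddfMn snd) /= hz; congr (_ + _).
by apply: eq_bigr => i _; rewrite (raddfMn snd).
Qed.

Lemma p_separated_prod (U V : zmodType) :
  p_separated U -> p_separated V -> p_separated (U * V)%type.
Proof.
move=> sU sV [x y] h; congr (_, _).
  by apply: sU => n; have [z /(congr1 fst)] := h n; rewrite raddfMn => hz; exists z.1.
by apply: sV => n; have [z /(congr1 snd)] := h n; rewrite raddfMn => hz; exists z.2.
Qed.

(** Write d = f y_0 + p d_1, d_1 = f y_1 + p d_2, and so on. The series of the y_i p^i converges in
    U, and the image of its sum differs from d by an element divisible by every p^n. *)
Lemma surj_mod_p (U V : zmodType) (f : {additive U -> V}) :
  p_complete U -> p_separated V ->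
  (forall d, exists y z, d = f y + z *+ p) -> forall d, exists y, f y = d.
Proof.
move=> cU sV h d.
have h' d0 : exists F : U * V, d0 = f F.1 + F.2 *+ p.
  by have [y [z]] := h d0; exists (y, z).
have [F hF] := choice h'.
pose D n := iter n (fun d => (F d).2) d.
have DE n : d = f (\sum_(i < n) (F (D i)).1 *+ p ^ i) + D n *+ p ^ n.
  elim: n => [|n {1}->]; first by rewrite big_ord0 raddf0 add0r.
  rewrite big_ord_recr /= [in RHS]raddfD -addrA; congr (_ + _).
  by rewrite raddfMn expnS mulrnA -mulrnDl -hF.
have [t ht] := cU (fun i => (F (D i)).1); exists t.
apply/subr0_eq/sV => n; have [z hz] := ht n.
exists (f z - D n); rewrite [in LHS](DE n) hz raddfD raddfMn opprD addrACA subrr add0r.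
by rewrite mulrnBl.
Qed.

End Complete.

(** * W(k) as a complete discrete valuation ring *)

Section WittValuation.
Variables (k : closedFieldType) (p : nat) (hp : p \in [pchar k]).
Local Notation W := (witt hp).
Local Notation sigma := (@witt_frob k p hp).
Local Notation P := (p%:R : W).

Lemma witt_p_complete : p_complete p W.
Proof.
move=> s; pose S n : W := \sum_(i < n) s i *+ p ^ i.
have SS n i : (i <= n)%N -> modeq (p ^ i) (S n) (S i).
  elim: n => [|n IHn]; first by rewrite leqn0 => /eqP ->; apply: modeq_refl.
  rewrite leq_eqVlt => /orP[/eqP ->|]; first exact: modeq_refl.
  rewrite ltnS => le_i_n; apply: modeq_trans (IHn le_i_n).
  suff: modeq (p ^ n) (S n.+1) (S n) by exact: modeq_dvd (dvdn_exp2l p le_i_n).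
  by exists (s n); rewrite /S big_ord_recr.
(* Coordinate i no longer changes from the partial sum [S i.+1] on, so the limit is read off
   diagonally. *)
pose t : W := Witt hp (fun i => wcoord (S i.+1) i).
exists t => n; suff [z ->] : modeq (p ^ n) t (S n) by exists z.
apply/wcoord_modeq => i lt_i_n.
by have /wcoord_modeq/(_ i (ltnSn i)) -> := SS n i.+1 lt_i_n.
Qed.

Lemma witt_p_separated : p_separated p W.
Proof.
move=> x h; apply: wcoord_inj; apply/funext => i.
by have /wcoord_dvd/(_ i (ltnSn i)) := h i.+1.
Qed.

(** Multiplication by an element of nonzero residue is additive and surjective modulo p, hence
    reaches 1. *)
Lemma witt_unitP (x : W) : reflect (residue x <> 0) (x \is a GRing.unit).
Proof.
apply: (iffP idP) => [/(rmorph_unit (@residue k p hp))|x0].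
  by rewrite unitfE => /eqP.
pose f y : W := y * x.
have fB : zmod_morphism f by move=> y z; rewrite /f mulrBl.
pose fA := HB.pack_for {additive W -> W} f (GRing.isZmodMorphism.Build W W f fB).
have [|y hy] := @surj_mod_p p _ _ fA witt_p_complete witt_p_separated _ 1.
  move=> d; have [y hy] := residue_surj hp (residue d / residue x).
  have /residue_eq0 [z hz] : residue (d - y * x) = 0.
    by rewrite rmorphB rmorphM /= hy divfK ?subrr //; apply/eqP.
  by exists y, z; rewrite -mulr_natl -hz /= /f addrC subrK.
by apply/unitrPr; exists y; rewrite mulrC -hy.
Qed.

Lemma residue_p : residue P = 0.
Proof. by rewrite rmorph_nat (pcharf0 hp). Qed.

Lemma witt_p_neq0 : P != 0.
Proof.
apply/eqP => h; have := wcoordMp (1 : W); rewrite h => /(congr1 (fun c => c 1)) /=.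
by rewrite /wone /= expr1n => /esym/eqP; rewrite oner_eq0.
Qed.

Lemma witt_pX_neq0 n : P ^+ n != 0.
Proof. by rewrite expf_neq0 // witt_p_neq0. Qed.

(** Take for n the index of the first nonzero coordinate; if the cofactor had residue 0, then
    p^(n+1) would divide x. *)
Lemma witt_decomp (x : W) : x != 0 -> exists n u, x = P ^+ n * u /\ u \is a GRing.unit.
Proof.
move=> /witt_lead[n [xn h]]; have [y hy] := (wcoord_dvd x n).2 h.
exists n, y; split; first by rewrite -natrX mulr_natl.
apply/witt_unitP => /residue_eq0 [z hz]; case/eqP: xn.
have [h' _] := wcoord_dvd x n.+1; apply: h' => //; exists z.
by rewrite hy hz mulr_natl expnS mulrnA.
Qed.

Lemma sigma_p n : sigma (P ^+ n) = P ^+ n.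
Proof. by rewrite rmorphXn rmorph_nat. Qed.

Lemma sigma_eq0 (x : W) : (sigma x == 0) = (x == 0).
Proof.
have [s hs _] := witt_frob_bij hp.
apply/eqP/eqP => [|->]; last by rewrite rmorph0.
by move=> h; rewrite -(hs x) h -[in LHS](rmorph0 sigma) hs.
Qed.

End WittValuation.

(** * Rank-two crystals *)

Section RankTwoBases.
Variable R : comUnitRingType.

Definition basis2 (M : lmodType R) (e1 e2 : M) : Prop :=
  (forall u, exists x y, u = x *: e1 + y *: e2) /\
  (forall x y, x *: e1 + y *: e2 = 0 -> x = 0 /\ y = 0).

Lemma basis2_inj (M : lmodType R) (e1 e2 : M) x y x' y' : basis2 e1 e2 ->
  x *: e1 + y *: e2 = x' *: e1 + y' *: e2 -> x = x' /\ y = y'.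
Proof.
move=> [_ h] /eqP; rewrite -subr_eq0 opprD addrACA -!scalerBl => /eqP/h[/eqP + /eqP].
by rewrite !subr_eq0 => /eqP -> /eqP ->.
Qed.

Lemma basis2_comb (M : lmodType R) (e1 e2 : M) a b x y z t :
  a *: (x *: e1 + y *: e2) + b *: (z *: e1 + t *: e2) =
  (a * x + b * z) *: e1 + (a * y + b * t) *: e2.
Proof. by rewrite !scalerDr !scalerA addrACA -!scalerDl. Qed.

Lemma basis2_change (M : lmodType R) (e1 e2 : M) a b c d : basis2 e1 e2 ->
  a * d - b * c \is a GRing.unit ->
  basis2 (a *: e1 + c *: e2) (b *: e1 + d *: e2).
Proof.
move=> he ud; set D := _ - _ in ud; split=> [u|x y].
  have [x [y ->]] := he.1 u.
  have E n m q r : (n / D * q + m / D * r) * D = n * q + m * r.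
    by transitivity ((n * q + m * r) * (D^-1 * D)); [ring | rewrite mulVr // mulr1].
  exists ((d * x - b * y) / D), ((a * y - c * x) / D); rewrite basis2_comb.
  by congr (_ *: _ + _ *: _); apply: (mulIr ud); rewrite E /D; ring.
rewrite basis2_comb => /he.2[h1 h2].
split; apply: (mulIr ud); rewrite mul0r /D.
  transitivity (d * (x * a + y * b) - b * (x * c + y * d)); first by ring.
  by rewrite h1 h2 !mulr0 subrr.
transitivity (a * (x * c + y * d) - c * (x * a + y * b)); first by ring.
by rewrite h1 h2 !mulr0 subrr.
Qed.

Lemma basis2_det (M : lmodType R) (e1 e2 : M) a b c d : basis2 e1 e2 ->
  basis2 (a *: e1 + c *: e2) (b *: e1 + d *: e2) -> a * d - b * c \is a GRing.unit.
Proof.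
move=> he [h _]; have [x [y h1]] := h e1; have [z [t h2]] := h e2.
have E1 : 1 *: e1 + 0 *: e2 = e1 by rewrite scale1r scale0r addr0.
have E2 : 0 *: e1 + 1 *: e2 = e2 by rewrite scale1r scale0r add0r.
rewrite basis2_comb in h1; rewrite basis2_comb in h2.
have [x1 x2] := basis2_inj he (etrans E1 h1).
have [y1 y2] := basis2_inj he (etrans E2 h2).
apply/unitrPr; exists (x * t - y * z).
transitivity ((x * a + y * b) * (z * c + t * d) - (x * c + y * d) * (z * a + t * b)); first by ring.
by rewrite -x1 -x2 -y1 -y2; ring.
Qed.

Lemma basis2_sym (M : lmodType R) (e1 e2 : M) : basis2 e1 e2 -> basis2 e2 e1.
Proof.
case=> h1 h2; split=> [u|x y]; last by rewrite addrC => /h2[].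
by have [x [y ->]] := h1 u; exists y, x; rewrite addrC.
Qed.

Lemma basis2_bij (M N : lmodType R) (g : {linear M -> N}) (e1 e2 : M) :
  bijective g -> basis2 e1 e2 -> basis2 (g e1) (g e2).
Proof.
case=> h gK hK [h1 h2]; split=> [u|x y].
  by have [x [y]] := h1 (h u); move=> /(congr1 g); rewrite hK linearD !linearZ; exists x, y.
rewrite -!linearZ -linearD => /(congr1 h); rewrite gK -(linear0 g) gK.
exact: h2.
Qed.

Lemma basis2_linear (M N : lmodType R) (e1 e2 : M) (f1 f2 : N) :
  basis2 e1 e2 -> basis2 f1 f2 ->
  exists g : {linear M -> N}, bijective g /\
    forall x y, g (x *: e1 + y *: e2) = x *: f1 + y *: f2.
Proof.
(* As a bare function the extension can be built in both directions; the reverse one is the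
   inverse. *)
suff ext (U V : lmodType R) (e1' e2' : U) (f1' f2' : V) : basis2 e1' e2' ->
    exists g : U -> V, linear g /\
      forall x y, g (x *: e1' + y *: e2') = x *: f1' + y *: f2'.
  move=> he hf; have [g [gL gE]] := ext _ _ _ _ f1 f2 he.
  have [h [_ hE]] := ext _ _ _ _ e1 e2 hf.
  exists (HB.pack_for {linear M -> N} g (GRing.isLinear.Build R M N *:%R g gL)).
  split=> //=; exists h => u.
    by have [x [y ->]] := he.1 u; rewrite gE hE.
  by have [x [y ->]] := hf.1 u; rewrite hE gE.
move=> he; have hxy u : exists xy : R * R, u = xy.1 *: e1' + xy.2 *: e2'.
  by have [x [y ->]] := he.1 u; exists (x, y).
have [c hc] := choice hxy.
have cE x y : c (x *: e1' + y *: e2') = (x, y).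
  have /(basis2_inj he)[] := hc (x *: e1' + y *: e2').
  by case: (c _) => ? ? /= -> ->.
exists (fun u => (c u).1 *: f1' + (c u).2 *: f2'); split=> [a u v|x y]; last by rewrite cE.
rewrite {1 2}(hc u) {1 2}(hc v) scalerDr !scalerA addrACA -!scalerDl cE /=.
by rewrite !scalerDl scalerDr !scalerA addrACA.
Qed.

End RankTwoBases.

Section Crystals.
Variables (k : closedFieldType) (p : nat) (hp : p \in [pchar k]).
Local Notation W := (witt hp).
Local Notation sigma := (@witt_frob k p hp).

Lemma basis2_exists (M : vectType W) : dim M = 2%N -> exists e1 e2 : M, basis2 e1 e2.
Proof.
move=> dM; pose i0 : 'I_(dim M) := cast_ord (esym dM) ord0.
pose i1 : 'I_(dim M) := cast_ord (esym dM) ord_max.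
pose e i : M := r2v (delta_mx 0 i).
have sum2 (v : 'rV[W]_(dim M)) : r2v v = v 0 i0 *: e i0 + v 0 i1 *: e i1.
  rewrite -!linearZ -linearD; congr r2v; apply/rowP => i; rewrite !mxE eqxx /=.
  have [->|->] : i = i0 \/ i = i1.
    have : (i < 2)%N by rewrite -dM.
    by case: i => [[|[|[]]]] // h _; [left|right]; apply: val_inj.
    by rewrite eqxx mulr1 (_ : (i0 == i1) = false) // mulr0 addr0.
  by rewrite eqxx mulr1 (_ : (i1 == i0) = false) // mulr0 add0r.
exists (e i0), (e i1); split=> [u|x y].
  by exists (v2r u 0 i0), (v2r u 0 i1); rewrite -sum2 v2rK.
pose v : 'rV[W]_(dim M) := \row_i (if i == i0 then x else y).
have -> : x = v 0 i0 by rewrite mxE eqxx.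
have -> : y = v 0 i1 by rewrite mxE.
rewrite -sum2 => /(congr1 v2r); rewrite r2vK linear0 => ->.
by rewrite !mxE.
Qed.

Definition semilinear_frob (M : lmodType W) (phi : M -> M) : Prop :=
  forall a u v, phi (a *: u + v) = sigma a *: phi u + phi v.

Section Semilinear.
Variables (M : lmodType W) (phi : M -> M).
Hypothesis sphi : semilinear_frob phi.

Lemma semilin0 : phi 0 = 0.
Proof.
have := sphi 1 0 0; rewrite scaler0 addr0 rmorph1 scale1r => /eqP.
by rewrite -subr_eq0 opprD addrA subrr sub0r oppr_eq0 => /eqP.
Qed.

Lemma semilinD u v : phi (u + v) = phi u + phi v.
Proof. by have := sphi 1 u v; rewrite rmorph1 !scale1r. Qed.

Lemma semilinZ a u : phi (a *: u) = sigma a *: phi u.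
Proof. by have := sphi a u 0; rewrite semilin0 !addr0. Qed.

Lemma semilin2 x y u v : phi (x *: u + y *: v) = sigma x *: phi u + sigma y *: phi v.
Proof. by rewrite semilinD !semilinZ. Qed.

End Semilinear.

Lemma fcrystal_iso_matrix (M N : vectType W) (phi : M -> M) (psi : N -> N)
    (e1 e2 : M) (f1 f2 : N) a b c d :
  semilinear_frob phi -> semilinear_frob psi -> basis2 e1 e2 -> basis2 f1 f2 ->
  phi e1 = a *: e1 + c *: e2 -> phi e2 = b *: e1 + d *: e2 ->
  psi f1 = a *: f1 + c *: f2 -> psi f2 = b *: f1 + d *: f2 ->
  fcrystal_iso phi psi.
Proof.
move=> sp sq he hf p1 p2 q1 q2; have [g [gb gE]] := basis2_linear he hf.
exists g; split=> // u; have [x [y ->]] := he.1 u.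
by rewrite gE !semilin2 // p1 p2 q1 q2 !basis2_comb gE.
Qed.

(** As sigma is bijective, phi maps M bijectively onto the lattice spanned by v1 and s v2, and e1,
    e2 are the preimages of a basis of that lattice. *)
Lemma basis2_semilinear (M : lmodType W) (phi : M -> M) (e1 e2 v1 v2 : M) s :
  semilinear_frob phi -> injective phi -> basis2 v1 v2 -> s != 0 ->
  (forall u, exists x y, phi u = x *: v1 + (s * y) *: v2) ->
  phi e1 = v1 -> phi e2 = s *: v2 -> basis2 e1 e2.
Proof.
move=> sp ip hv s0 h2 p1 p2; have [t ts st] := witt_frob_bij hp; split=> [u|x y].
  have [x [y hu]] := h2 u; exists (t x), (t y); apply: ip.
  by rewrite hu semilin2 // !st p1 p2 scalerA mulrC.
move=> /(congr1 phi); rewrite semilin2 // semilin0 // p1 p2 scalerA => /hv.2[].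
by move/eqP; rewrite sigma_eq0 => /eqP -> /eqP; rewrite mulf_eq0 (negPf s0) orbF sigma_eq0 => /eqP.
Qed.

End Crystals.

(** * Frobenius-linear equations over k and W(k) *)

Section Equations.
Variables (k : closedFieldType) (p : nat) (hp : p \in [pchar k]).
Local Notation W := (witt hp).
Local Notation sigma := (@witt_frob k p hp).
Local Notation P := (p%:R : W).
Local Notation residue := (@residue k p hp).
Let pr : prime p := pcharf_prime hp.

Lemma poly_solve n (A : k) (q : {poly k}) : A != 0 -> (0 < n)%N -> (size q <= n)%N ->
  exists X, A * X ^+ n = q.[X].
Proof.
move=> A0 n0 sq; have sA : size (A *: 'X^n) = n.+1 by rewrite size_scale // size_polyXn.
have : size (A *: 'X^n - q) != 1%N.
  rewrite size_polyDl; last by rewrite size_polyN sA ltnS.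
  by rewrite sA eqSS -lt0n.
move/closed_rootP => [X]; rewrite rootE !hornerE subr_eq0 => /eqP hX.
by exists X.
Qed.

Lemma frob_solve (A B C : k) : A != 0 -> exists X, A * X ^+ p = B * X + C.
Proof.
move=> A0; have [|X hX] := @poly_solve p A (B *: 'X + C%:P) A0 (prime_gt0 pr).
  apply: leq_trans (size_polyD _ _) _; rewrite geq_max.
  rewrite (leq_trans (size_scale_leq _ _)) ?size_polyX ?prime_gt1 //.
  by rewrite (leq_trans (size_polyC_leq1 _)) ?prime_gt0.
by exists X; rewrite hX !hornerE.
Qed.

Lemma frob_fixed (A : k) : A != 0 -> exists2 X, X != 0 & A * X ^+ p = X.
Proof.
move=> A0; have p1 : (0 < p.-1)%N by case: (p) (prime_gt1 pr) => [|[]].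
have [X hX] := root_exists A^-1 p1; exists X.
  by apply/eqP => X0; move/eqP: hX; rewrite X0 expr0n eqn0Ngt p1 eq_sym invr_eq0 (negPf A0).
by rewrite -(prednK (prime_gt0 pr)) exprS mulrCA hX divff ?mulr1.
Qed.

Lemma modeqP n (x y : W) : modeq (p ^ n) x y <-> exists z, x = y + P ^+ n * z.
Proof.
by split=> -[z ->]; exists z; rewrite -natrX mulr_natl.
Qed.

Lemma modeq_p_residue (x y : W) : modeq p x y <-> residue x = residue y.
Proof.
have := modeqP 1 x y; rewrite expn1 => ->; split=> [[z ->]|h].
  by rewrite expr1 rmorphD rmorphM /= residue_p mul0r addr0.
have /residue_eq0 [z hz] : residue (x - y) = 0 by rewrite rmorphB /= h subrr.
by exists z; rewrite expr1 -hz addrC subrK.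
Qed.

Lemma solve1 (f : W -> W) : zmod_morphism f ->
  (forall d, exists y, residue (f y) = residue d) -> forall d, exists y, f y = d.
Proof.
move=> fB h; pose fA := HB.pack_for {additive W -> W} f (GRing.isZmodMorphism.Build W W f fB).
apply: (@surj_mod_p p _ _ fA (@witt_p_complete k p hp) (@witt_p_separated k p hp)) => d.
by have [y /esym/modeq_p_residue[z hz]] := h d; exists y, z.
Qed.

Lemma solve2 (f : W * W -> W * W) : zmod_morphism f ->
  (forall d1 d2, exists y, residue (f y).1 = residue d1 /\ residue (f y).2 = residue d2) ->
  forall d, exists y, f y = d.
Proof.
move=> fB h.
pose fA := HB.pack_for {additive (W * W)%type -> (W * W)%type} f
  (GRing.isZmodMorphism.Build (W * W)%type (W * W)%type f fB).
apply: (@surj_mod_p p _ _ fA).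
- by apply: p_complete_prod; apply: witt_p_complete.
- by apply: p_separated_prod; apply: witt_p_separated.
case=> d1 d2; have [y [/esym/modeq_p_residue[z1 h1] /esym/modeq_p_residue[z2 h2]]] := h d1 d2.
exists y, (z1, z2); rewrite h1 h2 [RHS]surjective_pairing.
by congr (_, _); [rewrite (raddfD fst) (raddfMn fst) | rewrite (raddfD snd) (raddfMn snd)].
Qed.

(** A solution x0 modulo p lifts: if p z is its error, the correction p y has to satisfy n sigma y -
    y = - z, an equation that is solvable modulo p for every right-hand side. *)
Lemma frob_fixed_unit (n : W) : n \is a GRing.unit ->
  exists2 x, x \is a GRing.unit & n * sigma x = x.
Proof.
move=> /witt_unitP/eqP n0; have [X X0 hX] := frob_fixed n0.
have [x0 hx0] := residue_surj hp X.
have [z hz] : exists z, n * sigma x0 - x0 = P * z.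
  by apply/residue_eq0; rewrite rmorphB rmorphM /= residue_frob hx0 hX subrr.
have [||y hy] := @solve1 (fun y => n * sigma y - y) _ _ (- z).
- by move=> x y; rewrite rmorphB; ring.
- move=> d; have [Y hY] := frob_solve 1 (residue d) n0.
  have [y hy] := residue_surj hp Y; exists y.
  by rewrite rmorphB rmorphM /= residue_frob hy hY mul1r addrC addKr.
exists (x0 + P * y).
  apply/witt_unitP; rewrite rmorphD rmorphM /= residue_p mul0r addr0 hx0; exact/eqP.
rewrite rmorphD rmorphM /= rmorph_nat; apply/subr0_eq.
transitivity ((n * sigma x0 - x0) + P * (n * sigma y - y)); first by ring.
by rewrite hz hy; ring.
Qed.

End Equations.

(** * Bases adapted to the Hodge slopes *)

Section Adapted.
Variables (k : closedFieldType) (p : nat) (hp : p \in [pchar k]).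
Local Notation W := (witt hp).
Local Notation P := (p%:R : W).
Local Notation residue := (@residue k p hp).

(** Here v1 = a e1 + c e2 and v2 = b e1 + d e2; the determinant condition says that (v1, v2) is a
    basis. *)
Definition adapted (M : lmodType W) (phi : M -> M) e (e1 e2 : M) a b c d : Prop :=
  [/\ basis2 e1 e2, a * d - b * c \is a GRing.unit, phi e1 = a *: e1 + c *: e2 &
      phi e2 = P ^+ e *: (b *: e1 + d *: e2)].

Lemma witt_nonunit (x : W) : x \isn't a GRing.unit -> residue x = 0.
Proof. by move=> h; apply/eqP; apply: contraNT h => /eqP ?; apply/witt_unitP. Qed.

(** phi M is the set where the last coordinate h of the Hodge isomorphism vanishes modulo p^e. If h
    v1 is 0 modulo p^e and h v2 is a unit, phi M is spanned by v1 and p^e v2. *)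
Lemma hodge_adapted (M : vectType W) (phi : M -> M) e :
  semilinear_frob phi -> injective phi -> dim M = 2%N -> (0 < e)%N ->
  hodge_slopes phi [:: 0%N; e] ->
  exists e1 e2 a b c d, adapted phi e e1 e2 a b c d.
Proof.
move=> sp ip dM e0 [_ _ [f [fL fK fS]]].
have [m1 [m2 hm]] := basis2_exists dM.
(* The other coordinate matters only modulo p^0 = 1, so it carries no information. *)
pose h u := f u 0 ord_max.
have hL a u v : exists z, h (a *: u + v) = a * h u + h v + P ^+ e * z.
  by apply/modeqP; apply: (fL a u v ord_max).
have hK u : (exists v, u = phi v) <-> (exists z, h u = P ^+ e * z).
  rewrite -fK; split=> [/(_ ord_max)/modeqP[z hz]|[z hz] i].
    by exists z; rewrite add0r in hz.
  case: i => [[|[|i]]] //= hi; first by exists (f u 0 (Ordinal hi)); rewrite add0r mulr1n.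
  apply/modeqP; exists z; rewrite add0r -hz /h; congr (f u _ _); exact: val_inj.
have [w [z hw]] : exists w z, h w = 1 + P ^+ e * z.
  have [w hw] := fS (const_mx 1); have /modeqP[z hz] := hw ord_max.
  by exists w, z; rewrite /h hz mxE.
have [z0 h0] : exists z, h 0 = P ^+ e * z by apply/hK; exists 0; rewrite semilin0.
have hL2 x y u v : exists z, h (x *: u + y *: v) = x * h u + y * h v + P ^+ e * z.
  have [z1 ->] := hL x u (y *: v); have [z2] := hL y v 0; rewrite addr0 => ->.
  by rewrite h0; exists (z0 + z2 + z1); ring.
have rP t : residue (P ^+ e * t) = 0.
  by rewrite rmorphM rmorphXn /= residue_p expr0n eqn0Ngt e0 mul0r.
(* If h is a unit at one vector of a basis, a multiple of it is subtracted from the other to get v1.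
   Some basis vector qualifies, since h takes the value 1 modulo p^e. *)
have [v1 [v2 [hv [z1 hv1] hv2]]] : exists v1 v2, [/\ basis2 v1 v2,
    exists z, h v1 = P ^+ e * z & h v2 \is a GRing.unit].
  suff key (n1 n2 : M) : basis2 n1 n2 -> h n1 \is a GRing.unit ->
      exists v1 v2, [/\ basis2 v1 v2, exists z, h v1 = P ^+ e * z & h v2 \is a GRing.unit].
    have [h1|/witt_nonunit h1] := boolP (h m1 \is a GRing.unit); first exact: key hm h1.
    have [h2|/witt_nonunit h2] := boolP (h m2 \is a GRing.unit); first exact: key (basis2_sym hm) h2.
    have [x [y wE]] := hm.1 w; move/(congr1 residue): hw; rewrite wE.
    have [t ->] := hL2 x y m1 m2; rewrite !rmorphD rmorph1 /= !rP !rmorphM /= h1 h2.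
    by rewrite !mulr0 !addr0 => /esym/eqP; rewrite oner_eq0.
  move=> hn un; exists ((- (h n2 / h n1)) *: n1 + 1 *: n2), (1 *: n1 + 0 *: n2); split.
  - by apply: basis2_change => //; rewrite mulr0 mulr1 sub0r unitrN unitr1.
  - have [t ->] := hL2 (- (h n2 / h n1)) 1 n1 n2; exists t.
    by rewrite mulNr divrK // mul1r addNr add0r.
  - by rewrite scale0r addr0 scale1r.
have [e1 p1] : exists e1, phi e1 = v1.
  by have [_ []] := hK v1; [exists z1|move=> e1 ->; exists e1].
have hPv t : exists u, phi u = P ^+ e *: t.
  have [_ []] := hK (P ^+ e *: t); last by move=> u ->; exists u.
  by have := hL2 (P ^+ e) 0 t 0; rewrite scale0r addr0 mul0r addr0 => -[t1 ->]; exists (h t + t1); ring.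
have [e2 p2] := hPv v2.
have he : basis2 e1 e2.
  (* Both h (phi u) and h v1 vanish modulo p^e and h v2 is a unit, so p^e divides the v2-coordinate
     of phi u. *)
  apply: (basis2_semilinear sp ip hv (witt_pX_neq0 hp e) _ p1 p2) => u.
  have [x [y hu]] := hv.1 (phi u); exists x.
  have [t ht] : exists t, h (phi u) = P ^+ e * t by apply/hK; exists u.
  have [t1] := hL2 x y v1 v2; rewrite -hu ht hv1 => ht1.
  exists ((t - x * z1 - t1) / h v2); rewrite hu; congr (_ + _ *: _).
  apply: (mulIr hv2); rewrite -mulrA divrK //; apply/subr0_eq.
  by rewrite !mulrBr ht1; ring.
have [a [c v1E]] := he.1 v1; have [b [d v2E]] := he.1 v2.
exists e1, e2, a, b, c, d; split; rewrite -?v2E // ?p1 //.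
by apply: (basis2_det he); rewrite -v1E -v2E.
Qed.

End Adapted.

(** * The ordinary case: a is a unit *)

Section Ordinary.
Variables (k : closedFieldType) (p : nat) (hp : p \in [pchar k]).
Local Notation W := (witt hp).
Local Notation sigma := (@witt_frob k p hp).
Local Notation P := (p%:R : W).
Local Notation residue := (@residue k p hp).

Lemma residue_pX n (x : W) : (0 < n)%N -> residue (P ^+ n * x) = 0.
Proof. by move=> n0; rewrite rmorphM rmorphXn /= residue_p expr0n eqn0Ngt n0 mul0r. Qed.

Lemma residue_unit (x : W) : x \is a GRing.unit -> residue x != 0.
Proof. by move/witt_unitP/eqP. Qed.

(** g replaces (v1, v2) by (g v1, g v2) and leaves (e1, e2) and the factor p^e alone. *)
Lemma adapted_twist (M : lmodType W) (phi : M -> M) e e1 e2 a b c d (g : {linear M -> M}) n :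
  adapted phi e e1 e2 a b c d -> bijective g -> (forall u, exists w, g u = u + w *+ p ^ n) ->
  exists a' b' c' d',
    [/\ adapted (g \o phi) e e1 e2 a' b' c' d', modeq (p ^ n) a' a, modeq (p ^ n) b' b,
        modeq (p ^ n) c' c & modeq (p ^ n) d' d].
Proof.
move=> [he ud p1 p2] gb gE.
have key x y : exists x' y', [/\ g (x *: e1 + y *: e2) = x' *: e1 + y' *: e2,
    modeq (p ^ n) x' x & modeq (p ^ n) y' y].
  have [w gu] := gE (x *: e1 + y *: e2); have [s [t wE]] := he.1 w.
  exists (x + s *+ p ^ n), (y + t *+ p ^ n); split; [|by exists s|by exists t].
  by rewrite gu wE mulrnDl addrACA -!scaler_nat !scalerA -!scalerDl !mulr_natl.
have [a' [c' [g1 ha hc]]] := key a c; have [b' [d' [g2 hb hd]]] := key b d.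
exists a', b', c', d'; split=> //; split=> //=; last by rewrite p2 linearZ /= g2.
  by apply: (basis2_det he); rewrite -g1 -g2; apply/(basis2_bij gb)/basis2_change.
by rewrite p1 g1.
Qed.

Lemma semilinear_twist (M : lmodType W) (phi : M -> M) (g : {linear M -> M}) :
  semilinear_frob phi -> semilinear_frob (g \o phi).
Proof. by move=> sp a u v /=; rewrite sp linearP. Qed.

(** The coordinates of a vector fixed by phi, found modulo p and corrected by a multiple of p. As e
    > 0, the reduced equations a X^p = X and c X^p = Y are triangular. *)
Lemma unit_root_vector (a b c d : W) e : (0 < e)%N -> a \is a GRing.unit ->
  exists x y, [/\ x \is a GRing.unit, a * sigma x + P ^+ e * b * sigma y = x &
                  c * sigma x + P ^+ e * d * sigma y = y].
Proof.
move=> e0 /residue_unit a0.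
pose f (u : W * W) := (a * sigma u.1 + P ^+ e * b * sigma u.2 - u.1,
                       c * sigma u.1 + P ^+ e * d * sigma u.2 - u.2).
have f1 u : residue (f u).1 = residue a * residue u.1 ^+ p - residue u.1.
  by rewrite rmorphB rmorphD /= -mulrA residue_pX // addr0 rmorphM.
have f2 u : residue (f u).2 = residue c * residue u.1 ^+ p - residue u.2.
  by rewrite rmorphB rmorphD /= -mulrA residue_pX // addr0 rmorphM.
have fB : zmod_morphism f.
  by move=> u v; rewrite /f /= !rmorphB; congr (_, _) => /=; ring.
have [X X0 hX] := frob_fixed hp a0.
have [x0 hx0] := residue_surj hp X; have [y0 hy0] := residue_surj hp (residue c * X ^+ p).
have [z1 hz1] : exists z, (f (x0, y0)).1 = P * z.
  by apply/residue_eq0; rewrite f1 /= hx0 hX subrr.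
have [z2 hz2] : exists z, (f (x0, y0)).2 = P * z.
  by apply/residue_eq0; rewrite f2 /= hx0 hy0 subrr.
have [|[s t] hst] := solve2 fB _ (- z1, - z2).
  move=> d1 d2; have [S hS] := frob_solve hp 1 (residue d1) a0.
  have [s hs] := residue_surj hp S.
  have [t ht] := residue_surj hp (residue c * S ^+ p - residue d2).
  by exists (s, t); rewrite f1 f2 /= hs ht hS; split; ring.
exists (x0 + P * s), (y0 + P * t); split.
- by apply/witt_unitP; rewrite rmorphD rmorphM /= residue_p mul0r addr0 hx0; apply/eqP.
- apply/subr0_eq; rewrite !rmorphD !rmorphM !rmorph_nat /=.
  transitivity ((f (x0, y0)).1 + P * (f (s, t)).1); first by rewrite /f /=; ring.
  by rewrite hz1 hst /=; ring.
- apply/subr0_eq; rewrite !rmorphD !rmorphM !rmorph_nat /=.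
  transitivity ((f (x0, y0)).2 + P * (f (s, t)).2); first by rewrite /f /=; ring.
  by rewrite hz2 hst /=; ring.
Qed.

(** The fixed vector x spans a subcrystal, and phi acts on the quotient by p^e times a unit n.
    Rescaling by [eps] turns n into 1, and adding a multiple of x then splits the extension. *)
Lemma ordinary_form (M : lmodType W) (phi : M -> M) e e1 e2 a b c d :
  semilinear_frob phi -> (0 < e)%N -> adapted phi e e1 e2 a b c d ->
  a \is a GRing.unit ->
  exists x y, [/\ basis2 x y, phi x = x & phi y = P ^+ e *: y].
Proof.
move=> sp e0 [he ud p1 p2] ua.
have [x1 [x2 [ux1 h1 h2]]] := unit_root_vector b c d e0 ua.
pose x := x1 *: e1 + x2 *: e2.
have px : phi x = x.
  rewrite /x semilin2 // p1 p2 scalerA basis2_comb.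
  by congr (_ *: _ + _ *: _); [rewrite -[RHS]h1|rewrite -[RHS]h2]; ring.
have hx : basis2 x e2.
  have := basis2_change (a := x1) (b := 0) (c := x2) (d := 1) he.
  by rewrite scale0r add0r scale1r mul0r mulr1 subr0; apply.
(* The coordinates of v2 in the basis (x, e2). *)
pose m := b / x1; pose n := d - b * x2 / x1.
have pe2 : phi e2 = P ^+ e *: (m *: x + n *: e2).
  rewrite p2 /x; congr (_ *: _); rewrite scalerDr !scalerA -addrA -scalerDl; congr (_ *: _ + _ *: _).
    by rewrite /m divrK.
  by rewrite /n /m; ring.
(* Modulo p, n x1 equals x1^p (a d - b c), by the fixed point equations for x1 and x2. *)
clearbody x; have un : n \is a GRing.unit.
  apply/witt_unitP => n0.
  have r1 : residue x1 = residue a * residue x1 ^+ p.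
    by rewrite -[in LHS](h1) rmorphD -mulrA /= residue_pX // addr0 rmorphM.
  have r2 : residue x2 = residue c * residue x1 ^+ p.
    by rewrite -[in LHS]h2 rmorphD -mulrA /= residue_pX // addr0 rmorphM.
  have : residue (n * x1) = 0 by rewrite rmorphM /= n0 mul0r.
  have -> : n * x1 = d * x1 - b * x2 by rewrite /n mulrBl divrK.
  rewrite rmorphB !rmorphM /= r1 r2 => /eqP.
  have -> : residue d * (residue a * residue x1 ^+ p) - residue b * (residue c * residue x1 ^+ p)
     = residue x1 ^+ p * residue (a * d - b * c) by rewrite rmorphB !rmorphM /=; ring.
  by rewrite mulf_eq0 expf_eq0 (negPf (residue_unit ux1)) (negPf (residue_unit ud)) andbF.
have [eps ueps heps] := frob_fixed_unit un.
(* This equation makes p^e t x + eps e2 an eigenvector with eigenvalue p^e. *)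
have [||t ht] := @solve1 k p hp (fun t => sigma t - P ^+ e * t) _ _ (- (sigma eps * m)).
- by move=> s t; rewrite rmorphB; ring.
- move=> z; have [s _ hs] := witt_frob_bij hp; exists (s z).
  by rewrite hs rmorphB /= residue_pX // subr0.
exists x, ((P ^+ e * t) *: x + eps *: e2); split=> //.
  have := basis2_change (a := 1) (b := P ^+ e * t) (c := 0) (d := eps) hx.
  by rewrite scale0r addr0 scale1r mulr0 mul1r subr0; apply.
rewrite semilin2 // px pe2 !rmorphM /= sigma_p scalerA.
have -> : sigma t = P ^+ e * t - sigma eps * m by rewrite -ht addrC subrK.
rewrite !scalerDr !scalerA addrA -scalerDl; congr (_ *: _ + _ *: _); first by ring.
by rewrite -[in RHS]heps; ring.
Qed.

(** An isomorphism invariant that detects whether a is a unit. In rank at most 2, nilpotency modulo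
    p amounts to the vanishing of the square. *)
Definition nilpotent_mod_p (M : lmodType W) (phi : M -> M) : Prop :=
  forall u, exists w, phi (phi u) = P *: w.

(** Modulo p, phi kills e2 and sends e1 to a e1 + c e2, so the e1-coordinate of phi^2 e1 is
    a^(p+1). *)
Lemma adapted_nilpotent (M : lmodType W) (phi : M -> M) e e1 e2 a b c d :
  semilinear_frob phi -> (0 < e)%N -> adapted phi e e1 e2 a b c d ->
  nilpotent_mod_p phi <-> residue a = 0.
Proof.
case: e => // e sp _ [he ud p1 p2]; split=> [h|/residue_eq0[a' aE] u].
  have [w] := h e1; have [x [y ->]] := he.1 w.
  rewrite p1 semilin2 // p1 p2 scalerA basis2_comb scalerDr !scalerA.
  move/(basis2_inj he) => -[/(congr1 residue)] + _.
  rewrite rmorphD !rmorphM /= residue_frob exprS rmorphM /= residue_p !(mul0r, mulr0) addr0.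
  by move/eqP; rewrite -exprSr expf_eq0 /= => /eqP.
have [x [y ->]] := he.1 u.
have pu s t : exists w, phi (s *: e1 + t *: e2) = sigma s *: phi e1 + P *: w.
  by exists ((sigma t * P ^+ e) *: (b *: e1 + d *: e2)); rewrite semilin2 // p2 !scalerA exprS mulrCA.
have [w ->] := pu x y.
exists (sigma (sigma x) *: (sigma a' *: phi e1 + (sigma c * P ^+ e) *: (b *: e1 + d *: e2)) + phi w).
rewrite semilin2 // rmorph_nat [X in phi X]p1 semilin2 // p2 aE rmorphM rmorph_nat exprS.
move: (phi e1) (b *: e1 + d *: e2) (phi w) => u1 u2 u3.
rewrite !(scalerDr, scalerA); congr (_ *: _ + _ *: _ + _); ring.
Qed.

Lemma iso_nilpotent (M N : vectType W) (phi : M -> M) (psi : N -> N) :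
  fcrystal_iso phi psi -> nilpotent_mod_p phi -> nilpotent_mod_p psi.
Proof.
move=> [f [[g fK gK] fE]] h u; have [w hw] := h (g u); exists (f w).
by rewrite -[u in LHS]gK -!fE hw linearZ.
Qed.

End Ordinary.

(** * Direct sums of two crystals of rank 1 *)

Section DirectSums.
Variables (k : closedFieldType) (p : nat) (hp : p \in [pchar k]).
Local Notation W := (witt hp).
Local Notation sigma := (@witt_frob k p hp).
Local Notation P := (p%:R : W).
Local Notation residue := (@residue k p hp).

Lemma rank1_generator (M : vectType W) : dim M = 1%N ->
  exists m : M, (forall u, exists x, u = x *: m) /\ (forall x, x *: m = 0 -> x = 0).
Proof.
move=> dM; pose i0 : 'I_(dim M) := cast_ord (esym dM) ord0.
have i0E i : i = i0.
  by apply: val_inj => /=; have := ltn_ord i; rewrite [X in (_ < X)%N]dM; case: (val i).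
exists (r2v (delta_mx 0 i0)); split=> [u|x].
  exists (v2r u 0 i0); rewrite -linearZ -[u in LHS]v2rK; congr r2v.
  by apply/rowP => i; rewrite (i0E i) !mxE !eqxx mulr1.
rewrite -linearZ => /(congr1 v2r); rewrite r2vK linear0 => /rowP/(_ i0).
by rewrite !mxE !eqxx mulr1.
Qed.

Lemma rank1_nilpotent (M : vectType W) (phi : M -> M) :
  semilinear_frob phi -> dim M = 1%N -> nilpotent_mod_p phi ->
  forall u, exists w, phi u = P *: w.
Proof.
move=> sp dM nphi u; have [m [mg mf]] := rank1_generator dM.
have [c hc] := mg (phi m); have [w hw] := nphi m; have [y hy] := mg w.
have c0 : residue c = 0.
  have : (sigma c * c - P * y) *: m = 0.
    have h : phi (phi m) = sigma c *: (c *: m) by rewrite [X in phi X]hc semilinZ // hc.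
    by rewrite scalerBl -!scalerA -h hw hy subrr.
  move/mf/(congr1 residue); rewrite rmorphB !rmorphM /= residue_p mul0r subr0 residue_frob -exprSr.
  by move=> /eqP; rewrite rmorph0 expf_eq0 => /andP[_ /eqP].
have /residue_eq0[c' cE] := c0; have [x ->] := mg u; exists ((sigma x * c') *: m).
by rewrite semilinZ // hc cE !scalerA mulrCA.
Qed.

(** Otherwise both summands would be nilpotent modulo p, hence zero modulo p in rank 1, and p would
    divide phi e1 = v1, which belongs to a basis. *)
Lemma sum_rank1_ordinary (M : vectType W) (phi : M -> M) e e1 e2 a b c d :
  semilinear_frob phi -> (0 < e)%N -> adapted phi e e1 e2 a b c d ->
  sum_of_two_rank1 phi -> a \is a GRing.unit.
Proof.
move=> sp e0 ad [M1 [M2 [phi1 [phi2 [[[_ s1 _] d1] [[_ s2 _] d2] iso]]]]].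
apply/witt_unitP => a0; have [he ud p1 _] := ad.
have nsum := iso_nilpotent iso ((adapted_nilpotent sp e0 ad).2 a0).
have n1 : nilpotent_mod_p phi1.
  by move=> u; have [w /(congr1 fst) /= h] := nsum (u, 0); exists w.1.
have n2 : nilpotent_mod_p phi2.
  by move=> u; have [w /(congr1 snd) /= h] := nsum (0, u); exists w.2.
have [f [[g fK gK] fE]] := iso.
have [w hw] : exists w, phi e1 = P *: w.
  have [w1 h1] := rank1_nilpotent s1 d1 n1 (f e1).1.
  have [w2 h2] := rank1_nilpotent s2 d2 n2 (f e1).2.
  exists (g (w1, w2)); apply: (can_inj fK).
  by rewrite fE linearZ /= gK /fcrystal_sum h1 h2.
have [x [y wE]] := he.1 w; move: hw; rewrite p1 wE scalerDr !scalerA => /(basis2_inj he)[aE cE].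
case/witt_unitP: ud; rewrite aE cE rmorphB !rmorphM /= residue_p; ring.
Qed.

Lemma sum_rank1_of_diag (M : vectType W) (phi : M -> M) e x y :
  semilinear_frob phi -> basis2 x y -> phi x = x -> phi y = P ^+ e *: y ->
  sum_of_two_rank1 phi.
Proof.
move=> sp hxy px py.
pose phi1 : W^o -> W^o := sigma; pose phi2 : W^o -> W^o := fun u => P ^+ e * sigma u.
have s1 : semilinear_frob phi1 by move=> a u v; rewrite /phi1 rmorphD rmorphM.
have s2 : semilinear_frob phi2.
  by move=> a u v; rewrite /phi2 rmorphD rmorphM /= mulrDr mulrCA.
have sigma_inj : injective sigma by have [t h _] := witt_frob_bij hp; apply: can_inj h.
have dW : dim (W^o : vectType W) = 1%N by [].
exists W^o, W^o, phi1, phi2; split.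
- by split.
- split=> //; split=> //.
  by move=> u v /(mulfI (witt_pX_neq0 hp e))/sigma_inj.
have hb : basis2 ((1 : W^o), (0 : W^o)) ((0 : W^o), (1 : W^o)).
  split=> [[u v]|u v].
    by exists u, v; congr (_, _); rewrite /= ?scaler0 ?addr0 ?add0r; symmetry; apply: mulr1.
  move=> h; have h1 : u * 1 + v * 0 = 0 := congr1 fst h.
  have h2 : u * 0 + v * 1 = 0 := congr1 snd h.
  by rewrite mulr1 mulr0 addr0 in h1; rewrite mulr1 mulr0 add0r in h2.
apply: (fcrystal_iso_matrix (a := 1) (b := 0) (c := 0) (d := P ^+ e) sp _ hxy hb).
- by move=> a [u1 u2] [v1 v2]; rewrite /fcrystal_sum /= s1 s2.
- by rewrite px scale1r scale0r addr0.
- by rewrite py scale0r add0r.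
- rewrite /fcrystal_sum /phi1 /phi2 /= rmorph1 rmorph0 mulr0 scale0r addr0 scale1r //.
- rewrite /fcrystal_sum /phi1 /phi2 /= rmorph1 rmorph0 scale0r add0r.
  by congr (_, _); rewrite ?scaler0.
Qed.

Lemma ordinary_iso (M : vectType W) (phi psi : M -> M) e x y x' y' :
  semilinear_frob phi -> semilinear_frob psi -> basis2 x y -> basis2 x' y' ->
  phi x = x -> phi y = P ^+ e *: y -> psi x' = x' -> psi y' = P ^+ e *: y' ->
  fcrystal_iso phi psi.
Proof.
move=> sp sq h h' px py qx qy.
apply: (fcrystal_iso_matrix (a := 1) (b := 0) (c := 0) (d := P ^+ e) sp sq h h');
  by rewrite ?px ?py ?qx ?qy scale0r ?scale1r ?addr0 ?add0r.
Qed.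

Lemma ordinary_isomorphism_number (M : vectType W) (phi : M -> M) e e1 e2 a b c d :
  semilinear_frob phi -> (0 < e)%N -> adapted phi e e1 e2 a b c d ->
  a \is a GRing.unit -> isomorphism_number phi 1.
Proof.
move=> sp e0 ad ua; split=> [g gb gE|m hm].
  have sg : semilinear_frob (g \o phi) by exact: semilinear_twist.
  have [a' [b' [c' [d' [ad' ha _ _ _]]]]] := adapted_twist ad gb gE.
  have ua' : a' \is a GRing.unit.
    by apply/witt_unitP; move: ha; rewrite expn1 => /modeq_p_residue ->; apply/witt_unitP.
  have [x [y [hxy px py]]] := ordinary_form sp e0 ad ua.
  have [x' [y' [hxy' px' py']]] := ordinary_form sg e0 ad' ua'.
  exact: ordinary_iso hxy' hxy px' py' px py.
(* The bound 0 would allow every automorphism g, including the one taking (v1, v2) to (e2, e1), for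
   which g phi is nilpotent modulo p. *)
case: m hm => // hm; exfalso; have [he ud p1 p2] := ad.
have hv := basis2_change he ud.
have [g [gb gE]] := basis2_linear hv (basis2_sym he).
have sg : semilinear_frob (g \o phi) by exact: semilinear_twist.
have iso : fcrystal_iso (g \o phi) phi.
  by apply: hm => // u; exists (g u - u); rewrite addrC subrK.
have g1 := gE 1 0; rewrite !scale1r !scale0r !addr0 in g1.
have g2 := gE 0 1; rewrite !scale1r !scale0r !add0r in g2.
have adg : adapted (g \o phi) e e1 e2 0 1 1 0.
  split=> //=; first by rewrite mul0r mulr1 sub0r unitrN unitr1.
    by rewrite p1 g1 scale0r scale1r add0r.
  by rewrite p2 linearZ /= g2 scale0r scale1r addr0.
have := iso_nilpotent iso ((adapted_nilpotent sg e0 adg).2 (rmorph0 _)).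
by move/(adapted_nilpotent sp e0 ad); apply/witt_unitP.
Qed.

End DirectSums.

(** * Crystals with nilpotent reduction *)

Section Cyclic.
Variables (k : closedFieldType) (p : nat) (hp : p \in [pchar k]).
Local Notation W := (witt hp).
Local Notation sigma := (@witt_frob k p hp).
Local Notation P := (p%:R : W).
Local Notation residue := (@residue k p hp).
Let pr : prime p := pcharf_prime hp.

(** Reduces x = y to a [ring] identity that expresses x - y through a quantity z known to vanish. *)
Lemma eq_lincomb (R : comNzRingType) (x y z : R) : z = 0 -> x - y = z -> x = y.
Proof. by move=> -> /subr0_eq. Qed.

(* Rewriting with [combl], [combr] and [combD] reduces an identity between vectors in the span of
   [u] and [v] to two identities between coefficients. *)
Definition comb (M : lmodType W) (u v : M) x y := x *: u + y *: v.

Lemma combl (M : lmodType W) (u v : M) x : x *: u = comb u v x 0.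
Proof. by rewrite /comb scale0r addr0. Qed.

Lemma combr (M : lmodType W) (u v : M) y : y *: v = comb u v 0 y.
Proof. by rewrite /comb scale0r add0r. Qed.

Lemma combD (M : lmodType W) (u v : M) x y x' y' :
  comb u v x y + comb u v x' y' = comb u v (x + x') (y + y').
Proof. by rewrite /comb addrACA -!scalerDl. Qed.

Definition cyclic_form (M : lmodType W) (phi : M -> M) (alpha beta : W) (x : M) : Prop :=
  basis2 x (phi x) /\ phi (phi x) = alpha *: x + beta *: phi x.

Lemma cyclic_form_apply (M : lmodType W) (phi : M -> M) alpha beta x a b :
  semilinear_frob phi -> cyclic_form phi alpha beta x ->
  phi (a *: x + b *: phi x) = (alpha * sigma b) *: x + (sigma a + beta * sigma b) *: phi x.
Proof.
move=> sp [_ px]; rewrite semilin2 // px !(scalerDr, scalerA).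
by rewrite !(combl x (phi x)) !(combr x (phi x)) !combD; congr comb; ring.
Qed.

(** The unit u and the coefficient beta of the relation for phi^2 e1, obtained by substituting e2 =
    (phi e1 - a e1) / c. *)
Definition cyclic_unit (a b c d : W) : W := sigma c * (b * c - a * d) / c.
Definition cyclic_beta e (a c d : W) : W := sigma a + P ^+ e * (sigma c * d / c).

Lemma adapted_nonordinary (M : lmodType W) (phi : M -> M) e e1 e2 a b c d :
  adapted phi e e1 e2 a b c d -> residue a = 0 -> c \is a GRing.unit.
Proof.
move=> [_ ud _ _] a0; apply/witt_unitP => c0.
by case/witt_unitP: ud; rewrite rmorphB !rmorphM /= a0 c0 mul0r mulr0 subrr.
Qed.

Lemma unit_frob (x : W) : x \is a GRing.unit -> sigma x \is a GRing.unit.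
Proof. exact: rmorph_unit. Qed.

Lemma adapted_cyclic (M : lmodType W) (phi : M -> M) e e1 e2 a b c d :
  semilinear_frob phi -> adapted phi e e1 e2 a b c d -> residue a = 0 ->
  cyclic_form phi (P ^+ e * cyclic_unit a b c d) (cyclic_beta e a c d) e1.
Proof.
move=> sp ad a0; have uc := adapted_nonordinary ad a0; have [he ud p1 p2] := ad.
split.
  have := basis2_change (a := 1) (b := a) (c := 0) (d := c) he.
  by rewrite scale0r addr0 scale1r mulr0 mul1r subr0 -p1; apply.
rewrite [X in phi X]p1 semilin2 // p2 p1 /cyclic_unit /cyclic_beta.
rewrite !(scalerDr, scalerA) !(combl e1 e2) !(combr e1 e2) !combD.
have cV : 1 - c^-1 * c = 0 by rewrite mulVr // subrr.
congr comb.
  by apply: (@eq_lincomb W _ _ (sigma c * P ^+ e * b * (1 - c^-1 * c))); [rewrite cV mulr0 | ring].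
by apply: (@eq_lincomb W _ _ (sigma c * P ^+ e * d * (1 - c^-1 * c))); [rewrite cV mulr0 | ring].
Qed.

Lemma cyclic_unit_unit (a b c d : W) : c \is a GRing.unit -> a * d - b * c \is a GRing.unit ->
  cyclic_unit a b c d \is a GRing.unit.
Proof.
move=> uc ud; rewrite /cyclic_unit unitrMr ?unitrV // unitrMr ?unit_frob //.
by rewrite -unitrN opprB.
Qed.

Lemma residue_cyclic_beta e (a c d : W) : (0 < e)%N -> residue a = 0 ->
  residue (cyclic_beta e a c d) = 0.
Proof.
move=> e0 a0; rewrite rmorphD /= residue_frob a0 residue_pX // addr0.
by rewrite expr0n eqn0Ngt (prime_gt0 pr).
Qed.

Lemma modeqV n (x y : W) : x \is a GRing.unit -> y \is a GRing.unit ->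
  modeq n x y -> modeq n x^-1 y^-1.
Proof.
move=> ux uy h; have := modeqM (modeq_refl n (x^-1 * y^-1)) (modeq_sym h).
by rewrite -mulrA mulVr // mulr1 mulrAC mulVr // mul1r.
Qed.

Lemma modeq_frob n (x y : W) : modeq n x y -> modeq n (sigma x) (sigma y).
Proof. by case=> z ->; exists (sigma z); rewrite rmorphD rmorphMn. Qed.

Lemma cyclic_unit_modeq n (a b c d a' b' c' d' : W) :
  c \is a GRing.unit -> c' \is a GRing.unit ->
  modeq n a' a -> modeq n b' b -> modeq n c' c -> modeq n d' d ->
  modeq n (cyclic_unit a' b' c' d') (cyclic_unit a b c d).
Proof.
move=> uc uc' ha hb hc hd; apply: modeqM; last exact: modeqV.
by apply: modeqM; [exact: modeq_frob | apply: modeqD; [|apply: modeqN]; apply: modeqM].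
Qed.

Lemma cyclic_beta_modeq n e (a c d a' c' d' : W) :
  c \is a GRing.unit -> c' \is a GRing.unit ->
  modeq n a' a -> modeq n c' c -> modeq n d' d ->
  modeq n (cyclic_beta e a' c' d') (cyclic_beta e a c d).
Proof.
move=> uc uc' ha hc hd; apply: modeqD; first exact: modeq_frob.
apply: modeqM; first exact: modeq_refl.
apply: modeqM; last exact: modeqV.
by apply: modeqM => //; apply: modeq_frob.
Qed.

(** y is sent to z = a x + b phi x, which must satisfy the relation of y. The first equation
    compares the coefficients of x, divided by p^e u; the second those of phi x, after subtracting
    beta times the first. Modulo p the determinant of (z, phi z) is a^(p+1). *)
Lemma cyclic_iso (M : vectType W) (phi psi : M -> M) e u t beta beta' x y a b :
  semilinear_frob phi -> semilinear_frob psi -> (0 < e)%N -> residue beta = 0 ->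
  cyclic_form phi (P ^+ e * u) beta x -> cyclic_form psi (P ^+ e * (u * t)) beta' y ->
  a \is a GRing.unit ->
  sigma (sigma a) + sigma beta * sigma (sigma b) = beta' * sigma b + t * a ->
  P ^+ e * (sigma u * sigma (sigma b) - u * t * b) = beta' * sigma a - beta * t * a ->
  fcrystal_iso psi phi.
Proof.
move=> sp sq e0 b0 [hx px] [hy py] ua.
move=> /eqP; rewrite -subr_eq0 => /eqP; set S := (X in X = 0) => h1.
move=> /eqP; rewrite -subr_eq0 => /eqP; set T := (X in X = 0) => h2.
pose z := a *: x + b *: phi x.
have pz : phi z = (P ^+ e * u * sigma b) *: x + (sigma a + beta * sigma b) *: phi x.
  exact: cyclic_form_apply.
have hz : basis2 z (phi z).
  rewrite pz; apply: basis2_change => //; apply/witt_unitP.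
  have -> : a * (sigma a + beta * sigma b) - P ^+ e * u * sigma b * b =
    a * sigma a + a * beta * sigma b + P ^+ e * (- (u * sigma b * b)) by ring.
  rewrite rmorphD /= residue_pX // addr0 rmorphD !rmorphM /= b0 residue_frob mulr0 mul0r addr0.
  by apply/eqP; rewrite mulf_neq0 // ?expf_neq0 // residue_unit.
have ppz : phi (phi z) = (P ^+ e * (u * t)) *: z + beta' *: phi z.
  rewrite [X in phi X]pz semilin2 // px pz /z !rmorphD !rmorphM /= sigma_p.
  rewrite !(scalerDr, scalerA) !(combl x (phi x)) !(combr x (phi x)) !combD; congr comb.
    by apply: (eq_lincomb (z := P ^+ e * u * S)); [rewrite h1 mulr0 | rewrite /S; ring].
  by apply: (eq_lincomb (z := T + beta * S)); [rewrite h1 h2 mulr0 addr0 | rewrite /S /T; ring].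
have y1 : psi y = 0 *: y + 1 *: psi y by rewrite scale0r scale1r add0r.
have z1 : phi z = 0 *: z + 1 *: phi z by rewrite scale0r scale1r add0r.
exact: (fcrystal_iso_matrix sq sp hy hz y1 py z1 ppz).
Qed.

(** The image of y is some a x + b phi x, and cancelling p^e u recovers the system; a is a unit
    because this image and its image under phi form a basis. *)
Lemma cyclic_iso_inv (M : vectType W) (phi psi : M -> M) e u t beta beta' x y :
  semilinear_frob phi -> (0 < e)%N -> residue beta = 0 -> u \is a GRing.unit ->
  cyclic_form phi (P ^+ e * u) beta x -> cyclic_form psi (P ^+ e * (u * t)) beta' y ->
  fcrystal_iso psi phi ->
  exists a b, [/\ a \is a GRing.unit,
    sigma (sigma a) + sigma beta * sigma (sigma b) = beta' * sigma b + t * a &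
    P ^+ e * (sigma u * sigma (sigma b) - u * t * b) = beta' * sigma a - beta * t * a].
Proof.
move=> sp e0 b0 uu [hx px] [hy py] [f [fb fE]].
have [a [b fy]] := hx.1 (f y); exists a, b.
have pz : phi (f y) = (P ^+ e * u * sigma b) *: x + (sigma a + beta * sigma b) *: phi x.
  by rewrite fy; apply: cyclic_form_apply.
have hz : basis2 (f y) (phi (f y)) by rewrite -fE; apply: basis2_bij.
have ua : a \is a GRing.unit.
  move: hz; rewrite pz fy => /(basis2_det hx)/residue_unit hr.
  apply/witt_unitP => a0; case/eqP: hr.
  have -> : a * (sigma a + beta * sigma b) - P ^+ e * u * sigma b * b =
    a * (sigma a + beta * sigma b) + P ^+ e * (- (u * sigma b * b)) by ring.
  by rewrite rmorphD /= residue_pX // addr0 rmorphM /= a0 mul0r.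
have : phi (phi (f y)) = (P ^+ e * (u * t)) *: f y + beta' *: phi (f y).
  by rewrite -!fE py linearD !linearZ.
rewrite [X in phi X]pz semilin2 // px pz fy !rmorphD !rmorphM /= sigma_p.
rewrite !(scalerDr, scalerA) !(combl x (phi x)) !(combr x (phi x)) !combD /comb.
move=> /(basis2_inj hx) [h1 h2].
have h1' : sigma (sigma a) + sigma beta * sigma (sigma b) = beta' * sigma b + t * a.
  apply: (mulfI (witt_pX_neq0 hp e)); apply: (mulIr uu); apply/subr0_eq.
  by move/eqP: h1; rewrite -subr_eq0 => /eqP <-; ring.
split=> //; apply/subr0_eq.
move/eqP: h2; rewrite -subr_eq0 => /eqP h2.
move/eqP: h1'; rewrite -subr_eq0 => /eqP h1'.
apply: etrans _ (etrans (congr2 (fun s t => s - beta * t) h2 h1') _); ring.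
Qed.
End Cyclic.

(** * Solving the system: upper bounds *)

Section Bounds.
Variables (k : closedFieldType) (p : nat) (hp : p \in [pchar k]).
Local Notation W := (witt hp).
Local Notation sigma := (@witt_frob k p hp).
Local Notation P := (p%:R : W).
Local Notation residue := (@residue k p hp).
Let pr : prime p := pcharf_prime hp.
Local Notation frobk := (pFrobenius_aut hp).

Lemma frob2_solve (A B C D : k) : A != 0 ->
  exists X, A * (X ^+ p) ^+ p = B * X ^+ p + C * X + D.
Proof.
move=> A0; have p0 := prime_gt0 pr.
have [||X hX] := @poly_solve k (p ^ 2) A (B *: 'X^p + C *: 'X + D%:P) A0.
- by rewrite expn_gt0 p0.
- have pp : (p < p ^ 2)%N by rewrite -{1}(expn1 p) ltn_exp2l // prime_gt1.
  rewrite !(leq_trans (size_polyD _ _)) // !geq_max; apply/andP; split.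
    apply: leq_trans (size_polyD _ _) _; rewrite geq_max.
    rewrite !(leq_trans (size_scale_leq _ _)) // ?size_polyXn // size_polyX.
    exact: ltn_trans (prime_gt1 pr) pp.
  apply: leq_trans (size_polyC_leq1 _) _; exact: ltn_trans p0 pp.
by exists X; rewrite -exprM mulnn hX !hornerE.
Qed.

Lemma frob3_solve (A B C D E : k) : A != 0 ->
  exists X, A * ((X ^+ p) ^+ p) ^+ p = B * (X ^+ p) ^+ p + C * X ^+ p + D * X + E.
Proof.
move=> A0; have p0 := prime_gt0 pr.
have [||X hX] := @poly_solve k (p ^ 3) A (B *: 'X^(p ^ 2) + C *: 'X^p + D *: 'X + E%:P) A0.
- by rewrite expn_gt0 p0.
- have p1 := prime_gt1 pr.
  have pp : (p < p ^ 3)%N by rewrite -{1}(expn1 p) ltn_exp2l.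
  have pp2 : (p ^ 2 < p ^ 3)%N by rewrite ltn_exp2l.
  apply: leq_trans (size_polyD _ _) _; rewrite geq_max; apply/andP; split; last first.
    apply: leq_trans (size_polyC_leq1 _) _; exact: ltn_trans p0 pp.
  apply: leq_trans (size_polyD _ _) _; rewrite geq_max; apply/andP; split; last first.
    by rewrite (leq_trans (size_scale_leq _ _)) // size_polyX; apply: ltn_trans p1 pp.
  apply: leq_trans (size_polyD _ _) _; rewrite geq_max.
  by rewrite !(leq_trans (size_scale_leq _ _)) // size_polyXn.
by exists X; rewrite -!exprM mulnn -expnS hX !hornerE.
Qed.

(* If [C != 0], the second equation gives [A ^+ p - A] as a polynomial in [B]; substituting this
   in the first one leaves a single equation of degree [p ^ 3] in [B]. *)
Lemma residual_isoclinic (U V C C1 C2 d1 d2 : k) : U != 0 ->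
  exists A B, (A ^+ p) ^+ p - A + C1 * (B ^+ p) ^+ p - C2 * B ^+ p = d1 /\
    U * (B ^+ p) ^+ p - V * B - C * (A ^+ p - A) = d2.
Proof.
move=> U0; have [C0|C0] := eqVneq C 0.
  have [B hB] := frob2_solve 0 V d2 U0.
  have [A hA] := frob2_solve 0 1 (d1 + C2 * B ^+ p - C1 * (B ^+ p) ^+ p) (oner_neq0 k).
  exists A, B; rewrite mul1r mul0r add0r mul1r in hA.
  by rewrite C0 hB hA; split; ring.
have frD : {morph (fun x : k => x ^+ p) : x y / x + y} by move=> x y; apply: (rmorphD frobk).
have frN : {morph (fun x : k => x ^+ p) : x / - x} by move=> x; apply: (rmorphN frobk).
have UC : (U / C) ^+ p != 0 by rewrite expf_neq0 // mulf_neq0 // invr_eq0.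
have [B hB] := frob3_solve (- C1 - U / C) ((V / C) ^+ p + C2) (V / C)
  (d1 + (d2 / C) ^+ p + d2 / C) UC.
have [A hA] := frob_solve hp 1 ((U * (B ^+ p) ^+ p - V * B - d2) / C) (oner_neq0 k).
exists A, B; rewrite !mul1r in hA; rewrite hA; split; last by field.
rewrite frD hA; set c := _ / C.
have -> : c = U / C * (B ^+ p) ^+ p - V / C * B - d2 / C by rewrite /c; ring.
rewrite !frD !frN !exprMn; rewrite !exprMn in hB.
rewrite hB; ring.
Qed.

(** The second equation involves A alone; the first is then an equation for B with leading
    coefficient C^p. *)
Lemma residual_nonisoclinic (C d1 d2 : k) : C != 0 ->
  exists A B, (A ^+ p) ^+ p - A + C ^+ p * (B ^+ p) ^+ p - C * B ^+ p = d1 /\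
    - C * A ^+ p + C * A = d2.
Proof.
move=> C0; have [A hA] := frob_solve hp C (- d2) C0.
have Cp : C ^+ p != 0 by rewrite expf_neq0.
have [B hB] := frob2_solve C 0 (d1 - (A ^+ p) ^+ p + A) Cp.
by exists A, B; rewrite hB mulNr hA; split; ring.
Qed.

(** Look for a solution of the form (1 + p^w a, b). The first equation is then divisible by p^w and,
    as e <= 2 w, the second by p^e; the quotients reduce to the system of [residual_isoclinic]. *)
Lemma isoclinic_bound (M : vectType W) (phi psi : M -> M) e w u eta beta0 delta x y :
  semilinear_frob phi -> semilinear_frob psi -> (0 < e)%N -> (e <= w.*2)%N -> (0 < w <= e)%N ->
  u \is a GRing.unit ->
  cyclic_form phi (P ^+ e * u) (P ^+ w * beta0) x ->
  cyclic_form psi (P ^+ e * (u * (1 + P ^+ e * eta))) (P ^+ w * beta0 + P ^+ e * delta) y ->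
  fcrystal_iso psi phi.
Proof.
move=> sp sq e0 ew /andP[w0 we] uu hx hy.
pose t := 1 + P ^+ e * eta; pose beta0' := beta0 + P ^+ (e - w) * delta.
have Pe : P ^+ e = P ^+ w * P ^+ (e - w) by rewrite -exprD subnKC.
have P2w : P ^+ w * P ^+ w = P ^+ e * P ^+ (w.*2 - e) by rewrite -!exprD subnKC // addnn.
(* The linear part of the divided system; the constants arising from the summand 1 go to the
   right-hand side. *)
pose f (v : W * W) :=
  (sigma (sigma v.1) - v.1 + sigma beta0 * sigma (sigma v.2) - beta0' * sigma v.2
    - P ^+ e * (eta * v.1),
   sigma u * sigma (sigma v.2) - u * t * v.2 - P ^+ (w.*2 - e) * beta0 * (sigma v.1 - v.1)
    - P ^+ w * (delta * sigma v.1) + P ^+ w * (eta * (P ^+ w * beta0) * v.1)).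
have fB : zmod_morphism f.
  by move=> a b; rewrite /f /= !rmorphB; congr (_, _) => /=; ring.
have [|[a b] hab] := solve2 fB _ (P ^+ (e - w) * eta, delta - eta * (P ^+ w * beta0)).
  move=> d1 d2.
  have [A [B [hA hB]]] := residual_isoclinic (residue (u * t)) (residue (P ^+ (w.*2 - e) * beta0))
    (residue beta0 ^+ p) (residue beta0') (residue d1) (residue d2) (residue_unit (unit_frob uu)).
  have [a ha] := residue_surj hp A; have [b hb] := residue_surj hp B.
  exists (a, b); rewrite /f /=; split.
    rewrite rmorphB /= residue_pX // subr0 -hA !(rmorphB, rmorphD, rmorphM) /=.
    by rewrite !residue_frob ha hb.
  rewrite rmorphD rmorphB /= !residue_pX // addr0 subr0 -hB.
  by rewrite rmorphB rmorphB !(rmorphM residue) (rmorphB residue) /= !residue_frob ha hb.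
have h1 : (f (a, b)).1 = P ^+ (e - w) * eta by rewrite hab.
have h2 : (f (a, b)).2 = delta - eta * (P ^+ w * beta0) by rewrite hab.
apply: (cyclic_iso (t := t) (a := 1 + P ^+ w * a) (b := b) sp sq e0 _ hx hy).
- by rewrite residue_pX.
- by apply/witt_unitP; rewrite rmorphD /= residue_pX // addr0 rmorph1; apply/eqP/oner_neq0.
- apply: (eq_lincomb (z := P ^+ w * ((f (a, b)).1 - P ^+ (e - w) * eta))).
    by rewrite h1 subrr mulr0.
  rewrite /f /t /beta0' /= !(rmorphD, rmorphM, rmorph1) /= !sigma_p Pe; ring.
- apply: (eq_lincomb (z := P ^+ e * ((f (a, b)).2 - (delta - eta * (P ^+ w * beta0)))
    - (P ^+ w * P ^+ w - P ^+ e * P ^+ (w.*2 - e)) * beta0 * (sigma a - a))).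
    by rewrite h2 subrr mulr0 P2w subrr !mul0r subr0.
  rewrite /f /t /= !(rmorphD, rmorphM, rmorph1) /= !sigma_p; ring.
Qed.

(** Again 1 + p^w a is substituted for the first unknown, and the equations are divided by p^w and
    p^(2w). As 2 w < e, b drops out of the reduction of the second one. *)
Lemma nonisoclinic_bound (M : vectType W) (phi psi : M -> M) e w u eta beta0 delta x y :
  semilinear_frob phi -> semilinear_frob psi -> (0 < w)%N -> (w.*2 < e)%N ->
  beta0 \is a GRing.unit ->
  cyclic_form phi (P ^+ e * u) (P ^+ w * beta0) x ->
  cyclic_form psi (P ^+ e * (u * (1 + P ^+ w.*2 * eta))) (P ^+ w * beta0 + P ^+ w.*2 * delta) y ->
  fcrystal_iso psi phi.
Proof.
move=> sp sq w0 we ub hx hy; have e0 : (0 < e)%N by exact: leq_ltn_trans we.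
have w20 : (0 < w.*2)%N by rewrite double_gt0.
have ew0 : (0 < e - w.*2)%N by rewrite subn_gt0.
pose t := 1 + P ^+ w.*2 * eta.
have [beta0' b0E rb] : exists2 b, b = beta0 + P ^+ w * delta & residue b = residue beta0.
  by eexists; first reflexivity; rewrite rmorphD /= residue_pX // addr0.
have Pe : P ^+ e = P ^+ w.*2 * P ^+ (e - w.*2) by rewrite -exprD subnKC // ltnW.
have P2w : P ^+ w.*2 = P ^+ w * P ^+ w by rewrite -exprD addnn.
pose f (v : W * W) :=
  (sigma (sigma v.1) - v.1 + sigma beta0 * sigma (sigma v.2) - beta0' * sigma v.2
    - P ^+ w.*2 * (eta * v.1),
   P ^+ (e - w.*2) * (sigma u * sigma (sigma v.2) - u * t * v.2) - beta0' * sigma v.1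
    + beta0 * v.1 + P ^+ w.*2 * (eta * beta0 * v.1)).
have fB : zmod_morphism f.
  by move=> a b; rewrite /f /= !rmorphB; congr (_, _) => /=; ring.
have [|[a b] hab] := solve2 fB _ (P ^+ w * eta, delta - P ^+ w * eta * beta0).
  move=> d1 d2.
  have [A [B [hA hB]]] := residual_nonisoclinic (residue d1) (residue d2) (residue_unit ub).
  have [a ha] := residue_surj hp A; have [b hb] := residue_surj hp B.
  exists (a, b); rewrite /f /=; split.
    rewrite rmorphB /= residue_pX // subr0 -hA !(rmorphB, rmorphD, rmorphM) /=.
    by rewrite !residue_frob rb ha hb.
  rewrite rmorphD rmorphD rmorphB /= !residue_pX // addr0 sub0r -hB !rmorphM /= residue_frob rb ha.
  by rewrite mulNr.
have h1 : (f (a, b)).1 = P ^+ w * eta by rewrite hab.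
have h2 : (f (a, b)).2 = delta - P ^+ w * eta * beta0 by rewrite hab.
apply: (cyclic_iso (t := t) (a := 1 + P ^+ w * a) (b := b) sp sq e0 _ hx hy).
- by rewrite residue_pX.
- by apply/witt_unitP; rewrite rmorphD /= residue_pX // addr0 rmorph1; apply/eqP/oner_neq0.
- apply: (eq_lincomb (z := P ^+ w * ((f (a, b)).1 - P ^+ w * eta))).
    by rewrite h1 subrr mulr0.
  rewrite /f /t b0E /= !(rmorphD, rmorphM, rmorph1) /= !sigma_p P2w; ring.
- apply: (eq_lincomb (z := P ^+ w.*2 * ((f (a, b)).2 - (delta - P ^+ w * eta * beta0)))).
    by rewrite h2 subrr mulr0.
  rewrite /f /t b0E /= !(rmorphD, rmorphM, rmorph1) /= !sigma_p Pe P2w; ring.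
Qed.

End Bounds.

(** * Sharpness and isomorphism numbers *)

Section Numbers.
Variables (k : closedFieldType) (p : nat) (hp : p \in [pchar k]).
Local Notation W := (witt hp).
Local Notation sigma := (@witt_frob k p hp).
Local Notation P := (p%:R : W).
Local Notation residue := (@residue k p hp).

Lemma pX_unit_ndvd n (x y : W) : x \is a GRing.unit -> P ^+ n * x <> P ^+ n.+1 * y.
Proof.
move=> /residue_unit/eqP ux; rewrite exprSr -mulrA => /(mulfI (witt_pX_neq0 hp n)) xy.
by apply: ux; rewrite xy -[P]expr1 residue_pX.
Qed.

Lemma pX_dvd_leq m n (x y : W) : x \is a GRing.unit -> P ^+ n * x = P ^+ m * y -> (m <= n)%N.
Proof.
move=> ux xy; rewrite leqNgt; apply/negP => lt_n_m.
apply: (@pX_unit_ndvd n x (P ^+ (m - n.+1) * y) ux).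
by rewrite xy mulrA -exprD subnKC.
Qed.

(* If [p ^ e] does not divide [beta = p ^ v * beta1], then [s = - beta1] works for [v = e - 1]. For
   [v < e - 1] take [s = beta1 * tau]: the two equations force the residue [A] of [a] to satisfy
   [A ^ p = A] and [(T ^ p + T) * A = 0], where [T], the residue of [tau], is chosen such that
   [T ^ p + T = 1]. *)
Lemma isoclinic_obstruction e (u beta0 : W) : (0 < e)%N ->
  let beta := P ^+ uphalf e * beta0 in
  exists s, forall a b : W, a \is a GRing.unit ->
    sigma (sigma a) + sigma beta * sigma (sigma b) = (beta + P ^+ e.-1 * s) * sigma b + a ->
    P ^+ e * (sigma u * sigma (sigma b) - u * b) = (beta + P ^+ e.-1 * s) * sigma a - beta * a ->
    False.
Proof.
move=> e0 beta; have eE : e = e.-1.+1 by rewrite prednK.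
(* With s = 1 the second equation would make p^(e-1) sigma a divisible by p^e, although sigma a is a
   unit. *)
have caseA z : beta = P ^+ e * z -> exists s, forall a b : W, a \is a GRing.unit ->
    sigma (sigma a) + sigma beta * sigma (sigma b) = (beta + P ^+ e.-1 * s) * sigma b + a ->
    P ^+ e * (sigma u * sigma (sigma b) - u * b) = (beta + P ^+ e.-1 * s) * sigma a - beta * a ->
    False.
  move=> bE; exists 1 => a b ua _; rewrite bE mulr1 => h.
  apply: (@pX_unit_ndvd e.-1 (sigma a) (sigma u * sigma (sigma b) - u * b - z * sigma a + z * a)).
    exact: unit_frob.
  rewrite -eE; apply/subr0_eq; move/eqP: h; rewrite -subr_eq0 => /eqP h.
  by rewrite -[RHS]oppr0 -h; ring.
have [b0|/witt_decomp[v [beta1 [bE ub1]]]] := eqVneq beta 0.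
  by apply: (caseA 0); rewrite mulr0.
have wv : (uphalf e <= v)%N by apply: (pX_dvd_leq ub1); rewrite -bE.
have [ev|ve] := leqP e v.
  by apply: (caseA (P ^+ (v - e) * beta1)); rewrite mulrA -exprD subnKC.
have ev2 : (e <= v.*2)%N by lia.
rewrite {}bE {caseA wv beta}; have [j jE] : exists j, (e.-1 = v + j)%N by exists (e.-1 - v)%N; lia.
case: j jE => [|j] jE.
  exists (- beta1) => a b ua _; rewrite jE addn0 mulrN subrr mul0r sub0r => h.
  apply: (@pX_unit_ndvd v (beta1 * a) (- (sigma u * sigma (sigma b) - u * b))).
    by rewrite unitrM ub1.
  have -> : v.+1 = e by lia.
  by rewrite mulrN h opprK mulrA.
have [T hT] := frob_solve hp (- 1) 1 (oner_neq0 k).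
have [tau htau] := residue_surj hp T.
exists (beta1 * tau) => a b ua h1 h2.
pose X := sigma u * sigma (sigma b) - u * b.
have Pe1 : P ^+ e.-1 = P ^+ v * P ^+ j.+1 by rewrite jE exprD.
have Pe : P ^+ e = P ^+ v * P ^+ j.+1 * P by rewrite {1}eE exprSr Pe1.
pose D := - (tau * sigma a) + P * X / beta1.
have DE : D * beta1 = - (tau * sigma a * beta1) + P * X by rewrite mulrDl divrK // mulNr.
have hD : sigma a - a = P ^+ j.+1 * D.
  apply: (mulfI (witt_pX_neq0 hp v)); apply: (mulIr ub1); apply/subr0_eq.
  move/eqP: h2; rewrite -subr_eq0 Pe Pe1 => /eqP h2.
  have -> : P ^+ v * (P ^+ j.+1 * D) * beta1 =
    P ^+ v * (P ^+ j.+1 * (- (tau * sigma a * beta1) + P * X)).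
    by rewrite -DE; ring.
  by rewrite -[RHS]oppr0 -h2 /X; ring.
(* By the first equation p^v divides sigma^2 a - a, and v >= j + 2 follows from e <= 2 v and e = v +
   j + 2. *)
have [Y hY] : exists Y, sigma (sigma a) - a = P ^+ j.+2 * Y.
  exists (P ^+ (v - j.+2) *
    ((beta1 + P ^+ j.+1 * (beta1 * tau)) * sigma b - sigma beta1 * sigma (sigma b))).
  rewrite mulrA -exprD subnKC; last by lia.
  move/eqP: h1; rewrite -subr_eq0 Pe1 rmorphM /= sigma_p => /eqP h1.
  by apply: (eq_lincomb (z := _) h1); ring.
(* sigma^2 a - a = sigma (sigma a - a) + (sigma a - a) = p^(j+1) (sigma D + D), which is divisible
   by p^(j+2). *)
have : residue (sigma D + D) = 0.
  apply/residue_eq0; exists Y; apply: (mulfI (witt_pX_neq0 hp j.+1)).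
  rewrite mulrA -exprSr -hY mulrDr -[in X in X + _](sigma_p hp) -rmorphM -hD rmorphB /=; ring.
have rD : residue D = - (T * residue a).
  rewrite rmorphD rmorphN /= -mulrA -[P]expr1 residue_pX // addr0 rmorphM /= htau.
  congr (- (T * _)); have /(congr1 residue) := hD; rewrite residue_pX // rmorphB /=.
  by move/subr0_eq.
have ra : residue a ^+ p = residue a.
  by have /(congr1 residue) := hD; rewrite residue_pX // rmorphB /= residue_frob => /subr0_eq.
rewrite rmorphD /= residue_frob rD.
have -> : (- (T * residue a)) ^+ p = - (T ^+ p * residue a ^+ p).
  by rewrite -exprMn; apply: (rmorphN (pFrobenius_aut hp)).
rewrite ra; rewrite mul1r in hT; rewrite hT => h.
case/eqP: (residue_unit ua); apply: oppr_inj; rewrite oppr0 -h; ring.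
Qed.

(** e1 remains cyclic for g phi, and the formulas for u and beta preserve congruences modulo p^n;
    since u is a unit, its change can be written as a factor. *)
Lemma cyclic_twist (M : lmodType W) (phi : M -> M) e e1 e2 a b c d (g : {linear M -> M}) n :
  semilinear_frob phi -> adapted phi e e1 e2 a b c d -> residue a = 0 -> (0 < n)%N ->
  bijective g -> (forall u, exists w, g u = u + w *+ p ^ n) ->
  exists eta delta, cyclic_form (g \o phi)
    (P ^+ e * (cyclic_unit a b c d * (1 + P ^+ n * eta))) (cyclic_beta e a c d + P ^+ n * delta) e1.
Proof.
move=> sp ad a0 n0 gb gE.
have sg : semilinear_frob (g \o phi) by exact: semilinear_twist.
have [a' [b' [c' [d' [ad' ha hb hc hd]]]]] := adapted_twist ad gb gE.
have a0' : residue a' = 0 by have /modeqP[z ->] := ha; rewrite rmorphD /= residue_pX // a0 addr0.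
have uc := adapted_nonordinary ad a0; have uc' := adapted_nonordinary ad' a0'.
have [_ ud _ _] := ad; have uu := cyclic_unit_unit uc ud.
have /modeqP[z hz] := cyclic_unit_modeq uc uc' ha hb hc hd.
have /modeqP[delta hdelta] := cyclic_beta_modeq e uc uc' ha hc hd.
exists (z / cyclic_unit a b c d), delta; rewrite -hdelta.
have -> : cyclic_unit a b c d * (1 + P ^+ n * (z / cyclic_unit a b c d)) = cyclic_unit a' b' c' d'.
  by rewrite hz mulrDr mulr1 mulrA mulrC mulrA divrK // mulrC.
exact: (adapted_cyclic sg ad' a0').
Qed.

Lemma isoclinic_isomorphism_number (M : vectType W) (phi : M -> M) e e1 e2 a b c d beta0 :
  semilinear_frob phi -> (0 < e)%N -> adapted phi e e1 e2 a b c d -> residue a = 0 ->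
  cyclic_beta e a c d = P ^+ uphalf e * beta0 -> isomorphism_number phi e.
Proof.
move=> sp e0 ad a0 bE.
have uc := adapted_nonordinary ad a0; have [_ ud _ _] := ad.
have uu := cyclic_unit_unit uc ud; have := adapted_cyclic sp ad a0.
rewrite bE; set u := cyclic_unit a b c d in uu * => hx.
have sg (g : {linear M -> M}) : semilinear_frob (g \o phi) by exact: semilinear_twist.
split=> [g gb gE|m hm].
  have [eta [delta]] := cyclic_twist sp ad a0 e0 gb gE; rewrite bE.
  by apply: (isoclinic_bound sp (sg g) e0 _ _ uu hx); lia.
rewrite leqNgt; apply/negP => me.
have [s hs] := isoclinic_obstruction u beta0 e0.
have [t _ ht] := witt_frob_bij hp.
(* The g fixing e1 and sending phi e1 to f' keeps u and adds p^(e-1) s to beta. The coefficient is t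
   s, with t inverse to sigma, because phi is applied to f'. *)
pose f' := 1 *: phi e1 + (P ^+ e.-1 * t s) *: e1.
have [hb p2] := hx.
have hb' : basis2 e1 f'.
  have := basis2_change (a := 1) (b := P ^+ e.-1 * t s) (c := 0) (d := 1) hb.
  by rewrite scale0r addr0 scale1r mulr0 mul1r subr0 unitr1 [_ + 1 *: _]addrC; apply.
have [g [gb gE]] := basis2_linear hb hb'.
have g1 : g e1 = e1 by have := gE 1 0; rewrite !scale1r !scale0r !addr0.
have g2 : g (phi e1) = f' by have := gE 0 1; rewrite !scale1r !scale0r !add0r.
have iso : fcrystal_iso (g \o phi) phi.
  apply: hm => // v; have [y [z ->]] := hb.1 v; rewrite gE.
  exists ((z * P ^+ (e.-1 - m) * t s) *: e1).
  rewrite /f' scale1r scalerDr addrA -scaler_nat !scalerA natrX; congr (_ + _ *: _).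
  rewrite (_ : P ^+ e.-1 = P ^+ m * P ^+ (e.-1 - m)); first by ring.
  by rewrite -exprD subnKC //; lia.
have hy : cyclic_form (g \o phi) (P ^+ e * (u * 1)) (P ^+ uphalf e * beta0 + P ^+ e.-1 * s) e1.
  split; rewrite /= g2 //.
  have -> : phi f' = (P ^+ e * u) *: e1 + (P ^+ uphalf e * beta0 + P ^+ e.-1 * s) *: phi e1.
    by rewrite /f' semilin2 // p2 !rmorphM rmorph1 /= sigma_p ht scale1r -addrA -scalerDl.
  by rewrite gE mulr1.
have w0 : (0 < uphalf e)%N by lia.
have [a' [b' [ua h1 h2]]] := cyclic_iso_inv sp e0 (residue_pX beta0 w0) uu hx hy iso.
by rewrite mul1r in h1; rewrite !mulr1 in h2; apply: (hs a' b').
Qed.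

Lemma nonisoclinic_isomorphism_bound (M : vectType W) (phi : M -> M) e w e1 e2 a b c d beta0 :
  semilinear_frob phi -> adapted phi e e1 e2 a b c d -> residue a = 0 ->
  (0 < w)%N -> (w.*2 < e)%N -> beta0 \is a GRing.unit ->
  cyclic_beta e a c d = P ^+ w * beta0 -> isomorphism_bound phi w.*2.
Proof.
move=> sp ad a0 w0 we ub bE g gb gE.
have sg : semilinear_frob (g \o phi) by exact: semilinear_twist.
have w20 : (0 < w.*2)%N by rewrite double_gt0.
have [eta [delta]] := cyclic_twist sp ad a0 w20 gb gE.
have := adapted_cyclic sp ad a0; rewrite bE => hx hy.
exact: (nonisoclinic_bound sp sg w0 we ub hx hy).
Qed.

Lemma isomorphism_number_exists (M : vectType W) (phi : M -> M) n :
  isomorphism_bound phi n -> exists2 m, isomorphism_number phi m & (m <= n)%N.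
Proof.
move=> hn; have ex : exists m, `[< isomorphism_bound phi m >] by exists n; apply/asboolP.
exists (ex_minn ex); case: ex_minnP => m /asboolP hm minm.
  by split=> // m' /asboolP; apply: minm.
exact/minm/asboolP.
Qed.

End Numbers.

(** * Newton slopes *)

Section Growth.
Variables (k : closedFieldType) (p : nat) (hp : p \in [pchar k]).
Local Notation W := (witt hp).
Local Notation sigma := (@witt_frob k p hp).
Local Notation P := (p%:R : W).

Definition pdvd n (x : W) : Prop := exists y, x = P ^+ n * y.

Lemma pdvd0 x : pdvd 0 x.
Proof. by exists x; rewrite mul1r. Qed.

Lemma pdvd_leq m n x : (m <= n)%N -> pdvd n x -> pdvd m x.
Proof. by move=> mn [y ->]; exists (P ^+ (n - m) * y); rewrite mulrA -exprD subnKC. Qed.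

Lemma pdvdD n x y : pdvd n x -> pdvd n y -> pdvd n (x + y).
Proof. by move=> [a ->] [b ->]; exists (a + b); rewrite mulrDr. Qed.

Lemma pdvdM m n x y : pdvd m x -> pdvd n y -> pdvd (m + n) (x * y).
Proof. by move=> [a ->] [b ->]; exists (a * b); rewrite exprD; ring. Qed.

Lemma pdvd_unit n u x : u \is a GRing.unit -> pdvd n (u * x) <-> pdvd n x.
Proof.
move=> uu; split=> [[y hy]|[y ->]]; last by exists (u * y); rewrite mulrCA.
by exists (u^-1 * y); apply: (mulrI uu); rewrite hy mulrCA mulVKr.
Qed.

Lemma pdvd_frob n x : pdvd n (sigma x) <-> pdvd n x.
Proof.
split=> [[y hy]|[y ->]]; last by exists (sigma y); rewrite rmorphM /= sigma_p.
have [t ts st] := witt_frob_bij hp; exists (t y); apply: (can_inj ts).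
by rewrite hy rmorphM /= sigma_p st.
Qed.

Lemma pdvd_pX m n x : pdvd n (P ^+ m * x) <-> pdvd (n - m) x.
Proof.
split=> [[y hy]|[y ->]]; last first.
  apply: (@pdvd_leq _ (m + (n - m))); first by lia.
  by exists y; rewrite mulrA -exprD.
have [nm|mn] := leqP n m; first by rewrite (eqP nm); apply: pdvd0.
exists y; apply: (mulfI (witt_pX_neq0 hp m)).
by rewrite hy mulrA -exprD subnKC // ltnW.
Qed.

Lemma pdvd_all x : (forall n, exists2 m, (n <= m)%N & pdvd m x) -> x = 0.
Proof.
move=> h; apply: (@witt_p_separated k p hp) => n.
by have [m nm /(pdvd_leq nm)[y ->]] := h n; exists y; rewrite -natrX mulr_natl.
Qed.

Lemma pdvd_addr n x y : pdvd n y -> pdvd n (x + y) <-> pdvd n x.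
Proof.
move=> hy; split=> [h|h]; last exact: pdvdD.
rewrite -[x](addrK y); apply: pdvdD => //.
by have [z ->] := hy; exists (- z); rewrite mulrN.
Qed.

Section Gauge.
Variables (M : lmodType W) (phi : M -> M) (e : nat) (u beta : W) (x : M).
Hypothesis sp : semilinear_frob phi.
Hypothesis uu : u \is a GRing.unit.
Hypothesis hx : cyclic_form phi (P ^+ e * u) beta x.

Let phiE a b : phi (a *: x + b *: phi x) =
  (P ^+ e * (u * sigma b)) *: x + (sigma a + beta * sigma b) *: phi x.
Proof. by rewrite (cyclic_form_apply _ _ sp hx) mulrA. Qed.

(** Two indices, because the lattices used below weight x and phi x differently. *)
Definition gauge i j (v : M) : Prop :=
  exists a b, [/\ v = a *: x + b *: phi x, pdvd i a & pdvd j b].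

Lemma gaugeE i j a b : gauge i j (a *: x + b *: phi x) <-> pdvd i a /\ pdvd j b.
Proof.
split=> [[a' [b' [/(basis2_inj hx.1)[-> ->]]]]|[ha hb]] //.
by exists a, b.
Qed.

Lemma gauge_scale i j s v : gauge i j (P ^+ s *: v) <-> gauge (i - s) (j - s) v.
Proof.
have [a [b ->]] := hx.1.1 v.
by rewrite scalerDr !scalerA !gaugeE !pdvd_pX.
Qed.

Lemma gauge_zero v : (forall n, exists i j, [/\ n <= i, n <= j & gauge i j v]%N) -> v = 0.
Proof.
have [a [b ->]] := hx.1.1 v => h.
have -> : a = 0.
  by apply: pdvd_all => n; have [i [j [ni nj /gaugeE[]]]] := h n; exists i.
have -> : b = 0.
  by apply: pdvd_all => n; have [i [j [ni nj /gaugeE[]]]] := h n; exists j.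
by rewrite !scale0r addr0.
Qed.

(* The gauge of the lattice spanned by [x] and [p ^ (- e / 2) * phi x], on which [phi] acts as
   [p ^ (e / 2)] times an automorphism. *)
Lemma isoclinic_eigen r s v : pdvd (uphalf e) beta -> v != 0 ->
  iter r phi v = P ^+ s *: v -> (r * e = s.*2)%N.
Proof.
(* n counts half powers of p, rounded up to cover odd values; phi raises this index by exactly e. *)
move=> hb v0 hv; pose G n := gauge (uphalf n) (uphalf (n - e)).
have Gphi n w : G (n + e)%N (phi w) <-> G n w.
  have [a [b ->]] := hx.1.1 w; rewrite phiE /G !gaugeE addnK.
  rewrite pdvd_pX pdvd_unit // pdvd_frob (_ : uphalf (n + e) - e = uphalf (n - e))%N; last by lia.
  have hy : pdvd (uphalf (n - e)) b -> pdvd (uphalf n) (beta * sigma b).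
    move=> hb'; apply: (@pdvd_leq _ (uphalf e + uphalf (n - e))); first by lia.
    by apply: pdvdM => //; apply/pdvd_frob.
  split=> [[h1 h2]|[h1 h2]]; split=> //.
    by apply/pdvd_frob/(pdvd_addr _ (hy h1)).
  by apply/(pdvd_addr _ (hy h2))/pdvd_frob.
have Giter n : G (n + r * e)%N (iter r phi v) <-> G n v.
  elim: (r) => [|r' IH]; first by rewrite addn0.
  by rewrite iterS mulSn addnCA [(e + _)%N]addnC Gphi.
(* The eigenvalue equation shifts the index by r e - 2 s. A nonzero shift, followed forwards or
   backwards, would put v into every [G n]. *)
have GG n : G n v <-> G (n + r * e - s.*2)%N v.
  rewrite -Giter hv /G gauge_scale.
  rewrite (_ : uphalf (n + r * e) - s = uphalf (n + r * e - s.*2))%N; last by lia.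
  by rewrite (_ : uphalf (n + r * e - e) - s = uphalf (n + r * e - s.*2 - e))%N; last by lia.
have G0 : G 0 v.
  by have [a [b ->]] := hx.1.1 v; apply/gaugeE; split; apply: pdvd0.
have Gno : ~ (forall n, exists2 m, (n <= m)%N & G m v).
  move=> h; case/eqP: v0; apply: gauge_zero => n; have [m nm hm] := h (n.*2 + e)%N.
  by exists (uphalf m), (uphalf (m - e)); split=> //; lia.
apply/eqP; rewrite eqn_leq; apply/andP; split; rewrite leqNgt; apply/negP => lt; apply: Gno => n.
  exists (n * (r * e - s.*2))%N; first by rewrite leq_pmulr // subn_gt0.
  elim: n => [|n /GG]; first by rewrite mul0n.
  by rewrite -addnBA ?(ltnW lt) // addnC -mulSn.
exists n => //; have [N] := ubnP n; elim: N n => // N IH n /ltnSE nN.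
case: n nN => // n nN; apply/GG; apply: IH; lia.
Qed.

(* As above, with the lattice spanned by [x] and [p ^ (- w) * phi x], which [phi] maps into [p ^ w]
   times itself. *)
Lemma eigen_slope_ge w r s v : pdvd w beta -> (w.*2 <= e)%N -> v != 0 ->
  iter r phi v = P ^+ s *: v -> (r * w <= s)%N.
Proof.
move=> hb we v0 hv; pose G n := gauge n (n - w).
have Gphi n v' : G n v' -> G (n + w)%N (phi v').
  have [a [b ->]] := hx.1.1 v'; rewrite phiE /G !gaugeE addnK => -[h1 h2].
  split.
    apply/pdvd_pX; rewrite pdvd_unit // pdvd_frob; apply: pdvd_leq h2; lia.
  apply: pdvdD; first exact/pdvd_frob.
  apply: (@pdvd_leq _ (w + (n - w))); first by lia.
  by apply: pdvdM => //; apply/pdvd_frob.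
have Giter n : G n v -> G (n + r * w)%N (iter r phi v).
  elim: (r) => [|r' IH]; first by rewrite addn0.
  by move=> /IH; rewrite iterS mulSn addnCA [(w + _)%N]addnC; apply: Gphi.
have GG n : G n v -> G (n + r * w - s)%N v.
  move=> /Giter; rewrite hv /G gauge_scale.
  by rewrite (_ : n + r * w - w - s = n + r * w - s - w)%N //; lia.
have G0 : G 0 v.
  by have [a [b ->]] := hx.1.1 v; apply/gaugeE; split; apply: pdvd0.
rewrite leqNgt; apply/negP => lt; case/eqP: v0; apply: gauge_zero => n.
have h N : G (N * (r * w - s))%N v.
  elim: N => [|N /GG]; first by rewrite mul0n.
  by rewrite -addnBA ?(ltnW lt) // addnC -mulSn.
have hD : (n + w <= (n + w) * (r * w - s))%N by rewrite leq_pmulr // subn_gt0.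
have := h (n + w)%N; move: hD; set m := ((n + w) * _)%N => hD hm.
by exists m, (m - w)%N; split=> //; lia.
Qed.

Lemma independent_det v1 v2 a1 b1 a2 b2 :
  (forall a b, a *: v1 + b *: v2 = 0 -> a = 0 /\ b = 0) ->
  v1 = a1 *: x + b1 *: phi x -> v2 = a2 *: x + b2 *: phi x -> a1 * b2 - a2 * b1 != 0.
Proof.
move=> ind E1 E2.
apply/eqP => D0.
have [] := ind b2 (- b1).
  rewrite E1 E2 basis2_comb mulNr mulrC [b1 * a2]mulrC D0 scale0r add0r.
  by rewrite (_ : _ + _ = 0) ?scale0r //; ring.
move=> b20 /eqP; rewrite oppr_eq0 => /eqP b10.
have [] := ind a2 (- a1).
  by rewrite E1 E2 b10 b20 !scale0r !addr0 !scalerA -scalerDl mulNr mulrC subrr scale0r.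
move=> a20 /eqP; rewrite oppr_eq0 => /eqP a10.
have [] := ind 1 0; first by rewrite E1 a10 b10 !(scale0r, scaler0, addr0).
by move=> /eqP; rewrite oner_eq0.
Qed.

(** In the basis (x, phi x), phi adds e to the valuation of a determinant. On v1 and v2 its r-th
    iterate therefore adds r e, but also 2 s. *)
Lemma eigen_det r s v1 v2 :
  (forall a b, a *: v1 + b *: v2 = 0 -> a = 0 /\ b = 0) ->
  iter r phi v1 = P ^+ s *: v1 -> iter r phi v2 = P ^+ s *: v2 -> (r * e = s.*2)%N.
Proof.
move=> ind h1 h2; have [a1 [b1 E1]] := hx.1.1 v1; have [a2 [b2 E2]] := hx.1.1 v2.
have D0 := independent_det ind E1 E2.
pose Det v v' d := exists a b a' b', [/\ v = a *: x + b *: phi x, v' = a' *: x + b' *: phi x &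
   d = a * b' - a' * b].
have Dphi v v' d : Det v v' d -> Det (phi v) (phi v') (P ^+ e * (- u * sigma d)).
  move=> [a [b [a' [b' [-> -> ->]]]]]; rewrite !phiE.
  do 4!eexists; split; [reflexivity | reflexivity |].
  by rewrite rmorphB !rmorphM /=; ring.
have [d [ud dE]] : exists d, d \is a GRing.unit /\ exists n, a1 * b2 - a2 * b1 = P ^+ n * d.
  by have [n [d [dE ud]]] := witt_decomp D0; exists d; split=> //; exists n.
case: dE => n dE.
have Diter N : exists2 g, g \is a GRing.unit &
    Det (iter N phi v1) (iter N phi v2) (P ^+ (N * e + n) * g).
  elim: N => [|N [g ug hg]]; first by exists d => //; rewrite -dE; exists a1, b1, a2, b2.
  exists (- u * sigma g); first by rewrite unitrM unitrN uu unit_frob.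
  have := Dphi _ _ _ hg; rewrite !iterS rmorphM /= sigma_p.
  by rewrite mulSn -addnA [P ^+ (e + _)]exprD -mulrA [- u * (_ * _)]mulrCA.
have [g ug [a [b [a' [b' [F1 F2 F3]]]]]] := Diter r.
move: F1 F2; rewrite h1 h2 E1 E2 !scalerDr !scalerA.
move=> /(basis2_inj hx.1)[aE bE] /(basis2_inj hx.1)[aE' bE'].
have F : P ^+ (r * e + n) * g = P ^+ (s.*2 + n) * d.
  by rewrite F3 -aE -bE -aE' -bE' -addnn !exprD -mulrA -dE; ring.
apply/eqP; rewrite -(eqn_add2r n) eqn_leq.
by rewrite (pX_dvd_leq ud (esym F)) (pX_dvd_leq ug F).
Qed.

(** By [eigen_det] the slope s / r would be e / 2. But a multiple of phi x is a combination of v1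
    and v2, and its N-th iterate grows only like p^(N w), with w < e / 2. *)
Lemma nonisoclinic_eigen w beta0 r s v1 v2 : (0 < r)%N -> (w.*2 < e)%N ->
  beta0 \is a GRing.unit -> beta = P ^+ w * beta0 ->
  (forall a b, a *: v1 + b *: v2 = 0 -> a = 0 /\ b = 0) ->
  iter r phi v1 = P ^+ s *: v1 -> iter r phi v2 = P ^+ s *: v2 -> False.
Proof.
move=> r0 we ub bE ind h1 h2; have hrs := eigen_det ind h1 h2.
have [a1 [b1 E1]] := hx.1.1 v1; have [a2 [b2 E2]] := hx.1.1 v2.
have D0 := independent_det ind E1 E2.
have [d [D [dE uD]]] := witt_decomp D0.
have zE : (P ^+ d * D) *: phi x = (- a2) *: v1 + a1 *: v2.
  rewrite -dE E1 E2 basis2_comb (_ : - a2 * a1 + a1 * a2 = 0); last by ring.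
  by rewrite scale0r add0r; congr (_ *: _); ring.
(* The coordinate at phi x has valuation exactly m and dominates: phi multiplies it by p^w up to a
   unit and terms of higher valuation, while the new coordinate at x carries a factor p^e with e > 2
   w. *)
pose R m v := exists a b, b \is a GRing.unit /\ v = (P ^+ (m + w).+1 * a) *: x + (P ^+ m * b) *: phi x.
have Rphi m v : R m v -> R (m + w)%N (phi v).
  move=> [a [b [ubb ->]]]; rewrite phiE bE.
  exists (P ^+ (e - w.*2.+1) * (u * sigma b)), (P * sigma a + beta0 * sigma b); split.
    apply/witt_unitP; rewrite rmorphD /= -[P]expr1 residue_pX // add0r; apply/witt_unitP.
    by rewrite unitrM ub unit_frob.
  congr (_ *: _ + _ *: _); last by rewrite !rmorphM /= !sigma_p exprS !exprD; ring.
  rewrite rmorphM /= sigma_p; have -> : P ^+ e = P ^+ w.*2.+1 * P ^+ (e - w.*2.+1).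
    by rewrite -exprD subnKC.
  by rewrite -addnn !(exprS, exprD); ring.
have Riter N : R (d + N * w)%N (iter N phi ((P ^+ d * D) *: phi x)).
  elim: N => [|N IH]; last by rewrite iterS mulSn addnCA [(w + _)%N]addnC; apply: Rphi.
  by exists 0, D; split=> //; rewrite mulr0 scale0r add0r addn0.
have Eiter n : exists c1 c2,
    iter (n * r) phi ((P ^+ d * D) *: phi x) = P ^+ (n * s) *: (c1 *: v1 + c2 *: v2).
  rewrite zE; elim: n => [|n [c1 [c2 IH]]]; first by exists (- a2), a1; rewrite scale1r.
  have iterL N c c' v v' : iter N phi (c *: v + c' *: v') =
      iter N sigma c *: iter N phi v + iter N sigma c' *: iter N phi v'.
    by elim: N => //= N ->; rewrite semilin2.
  have iterS' N m : iter N sigma (P ^+ m) = P ^+ m by elim: N => //= N ->; rewrite sigma_p.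
  exists (iter r sigma c1), (iter r sigma c2).
  rewrite mulSn iterD IH.
  have -> : P ^+ (n * s) *: (c1 *: v1 + c2 *: v2) = P ^+ (n * s) *: (c1 *: v1 + c2 *: v2) + 0 *: v1.
    by rewrite scale0r addr0.
  rewrite iterL iterL h1 h2 iterS'.
  have -> : iter r sigma (0 : W) = 0 by elim: (r) => //= N ->; rewrite rmorph0.
  rewrite scale0r addr0 !scalerDr !scalerA mulSn exprD; congr (_ *: _ + _ *: _); ring.
(* As r e = 2 s, comparing the two growth rates gives n r <= 2 d, which this n contradicts. *)
pose n := d.*2.+1.
have [a [b [ubb F1]]] := Riter (n * r)%N; have [c1 [c2 F2]] := Eiter n.
have : (n * s <= d + n * r * w)%N.
  move: F2; rewrite F1 E1 E2 basis2_comb scalerDr !scalerA => /(basis2_inj hx.1)[_].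
  exact: pX_dvd_leq.
move=> h; have : (n * (r * e) <= n * (r * w.*2) + d.*2)%N by rewrite hrs -!doubleMr; lia.
have : (n * (r * w.*2.+1) <= n * (r * e))%N by rewrite !leq_mul2l we !orbT.
rewrite mulnS mulnDr => h3 h4.
have : (n * r <= d.*2)%N by lia.
rewrite leqNgt => /negP; apply; rewrite /n.
by apply: leq_trans (leq_pmulr _ r0).
Qed.

End Gauge.
End Growth.

Lemma mul_divK (F : fieldType) (q n d a : F) : d != 0 -> n != 0 ->
  q * n * (a / (n * d)) * d = q * a.
Proof. by move=> d0 n0; field; rewrite d0 n0. Qed.

Lemma iter_conj (T U : Type) (f : T -> U) F G :
  (forall v, f (F v) = G (f v)) -> forall N v, f (iter N F v) = iter N G (f v).
Proof. by move=> h; elim=> //= N IH v; rewrite h IH. Qed.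

(** * From Newton slopes to eigenvectors in M *)

Section Newton.
Variables (k : closedFieldType) (p : nat) (hp : p \in [pchar k]).
Local Notation W := (witt hp).
Local Notation K0 := {fraction witt hp}.
Local Notation sigma := (@witt_frob k p hp).
Local Notation P := (p%:R : W).
Local Notation "x %:F" := (@FracField.tofrac _ x).

Lemma isocrystalZ n (A : 'M[K0]_n) a (v : 'rV[K0]_n) :
  isocrystal A (a *: v) = frac_frob a *: isocrystal A v.
Proof. by rewrite /isocrystal map_mxZ scalemxAl. Qed.

Lemma isocrystal0 n (A : 'M[K0]_n) : isocrystal A 0 = 0.
Proof. by rewrite /isocrystal map_mx0 mul0mx. Qed.

Lemma frac_frob_pX n : frac_frob (p%:R ^+ n : K0) = p%:R ^+ n.
Proof. by rewrite rmorphXn rmorph_nat. Qed.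

Lemma iter_isocrystalZ n (A : 'M[K0]_n) N m (v : 'rV[K0]_n) :
  iter N (isocrystal A) (p%:R ^+ m *: v) = p%:R ^+ m *: iter N (isocrystal A) v.
Proof. by elim: N => //= N ->; rewrite isocrystalZ frac_frob_pX. Qed.

Lemma isocrystal_delta n (A : 'M[K0]_n) t : isocrystal A (delta_mx 0 t) = row t A.
Proof. by rewrite /isocrystal map_delta_mx -rowE. Qed.

(** The basis vectors of E_l are run through cyclically, and one full turn multiplies by p^s. *)
Lemma simple_eigen (l : rat) (t : 'I_(`|denq l|)) :
  iter `|denq l| (isocrystal (simple_mx hp l)) (delta_mx 0 t) =
  p%:R ^+ `|numq l| *: delta_mx 0 t.
Proof.
set r := `|denq l|%N in t *; set F := isocrystal _.
have r0 : (0 < r)%N by rewrite absz_gt0 denq_neq0.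
have step (i : 'I_r) (hi : (i.+1 < r)%N) : F (delta_mx 0 i) = delta_mx 0 (Ordinal hi).
  rewrite /F isocrystal_delta; apply/rowP => j; rewrite !mxE eqxx /=.
  by rewrite -/r (ltn_eqF hi).
have last0 (i : 'I_r) : i.+1 = r -> F (delta_mx 0 i) = p%:R ^+ `|numq l| *: delta_mx 0 (Ordinal r0).
  move=> hi; rewrite /F isocrystal_delta; apply/rowP => j; rewrite !mxE eqxx /=.
  by rewrite -/r hi eqxx mulr_natr.
have itert (i : nat) (hi : (i < r)%N) : iter i F (delta_mx 0 (Ordinal r0)) = delta_mx 0 (Ordinal hi).
  elim: i hi => [|i IH] hi; first by congr delta_mx; apply: val_inj.
  by rewrite iterS (IH (ltnW hi)) step; congr delta_mx; apply: val_inj.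
have full : iter r F (delta_mx 0 (Ordinal r0)) = p%:R ^+ `|numq l| *: delta_mx 0 (Ordinal r0).
  have hr : (r.-1 < r)%N by rewrite prednK.
  have iterP w : iter r F w = F (iter r.-1 F w) by rewrite -iterS prednK.
  by rewrite iterP (itert _ hr) last0 //= prednK.
(* e_t is F^t e_0, and F^t commutes with F^r and with the scalar p^s. *)
have tE : delta_mx 0 t = iter t F (delta_mx 0 (Ordinal r0)).
  by rewrite (itert t (ltn_ord t)); congr delta_mx; apply: val_inj.
rewrite tE -iterD addnC iterD full; exact: iter_isocrystalZ.
Qed.

Lemma submxrow_isocrystal m (q_ : 'I_m -> nat) (D : forall i, 'M[K0]_(q_ i)) v j :
  submxrow (isocrystal (\mxdiag_i D i) v) j = isocrystal (D j) (submxrow v j).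
Proof.
rewrite /isocrystal -{1}[map_mx _ v]submxrowK mul_mxrow_mxdiag mxrowK; congr (_ *m _).
by apply/matrixP => a b; rewrite !mxE.
Qed.

(** The vector is supported in one block, where [simple_eigen] applies; the other blocks stay
    zero. *)
Lemma mxdiag_eigen m (ls : 'I_m -> rat) (t : 'I_(\sum_i `|denq (ls i)|)) :
  let l := ls (tagnat.sig1 t) in
  iter `|denq l| (isocrystal (\mxdiag_(i < m) simple_mx hp (ls i))) (delta_mx 0 t) =
  p%:R ^+ `|numq l| *: delta_mx 0 t.
Proof.
move=> l; apply/mxrowP => j.
have -> N v : submxrow (iter N (isocrystal (\mxdiag_(i < m) simple_mx hp (ls i))) v) j =
    iter N (isocrystal (simple_mx hp (ls j))) (submxrow v j).
  by elim: N => //= N <-; rewrite submxrow_isocrystal.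
rewrite [RHS](_ : _ = p%:R ^+ `|numq l| *: submxrow (delta_mx 0 t) j); last first.
  by apply/matrixP => a b; rewrite !mxE.
have [jt|jt] := eqVneq j (tagnat.sig1 t).
  rewrite /l; subst j.
  have -> : submxrow (delta_mx 0 t) (tagnat.sig1 t) =
      delta_mx 0 (tagnat.sig2 t) :> 'rV[K0]_ _.
    apply/rowP => b; rewrite !mxE eqxx /=; congr (_%:R); congr nat_of_bool.
    have h := tagnat.eq_Rank b (tagnat.sig2 t); rewrite tagnat.sig2K eqxx in h.
    exact: etrans h _.
  exact: simple_eigen.
have -> : submxrow (delta_mx 0 t) j = 0 :> 'rV[K0]_ _.
  apply/rowP => b; rewrite !mxE eqxx /=; case: eqP => // tE.
  by case/eqP: jt; rewrite -tE tagnat.Rank1K.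
by rewrite scaler0; elim: (`|denq l|%N) => //= N ->; rewrite isocrystal0.
Qed.

Lemma tofrac_inj : injective (fun x : W => x%:F).
Proof. by move=> x y /eqP; rewrite tofrac_eq => /eqP. Qed.

Lemma frac_frob_tofrac (x : W) : frac_frob x%:F = (sigma x)%:F.
Proof. by rewrite -[in LHS](divr1 x%:F) -tofrac1 frac_frobE ?oner_neq0 // rmorph1 tofrac1 divr1. Qed.

Lemma pX_tofrac n : (P ^+ n)%:F = p%:R ^+ n :> K0.
Proof. by rewrite rmorphXn rmorph_nat. Qed.

Section Lattice.
Variables (M : vectType W) (phi : M -> M).
Hypothesis sp : semilinear_frob phi.

Definition to_isocrystal (u : M) : 'rV[K0]_(dim M) := map_mx (fun x : W => x%:F) (v2r u).

Lemma to_isocrystal_inj : injective to_isocrystal.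
Proof.
move=> u v /matrixP h; apply: (can_inj v2rK); apply/rowP => i.
by apply: tofrac_inj; have := h 0 i; rewrite !mxE.
Qed.

Lemma to_isocrystalZ a u : to_isocrystal (a *: u) = a%:F *: to_isocrystal u.
Proof. by apply/rowP => i; rewrite /to_isocrystal linearZ !mxE tofracM. Qed.

Lemma to_isocrystalD u v : to_isocrystal (u + v) = to_isocrystal u + to_isocrystal v.
Proof. by apply/rowP => i; rewrite /to_isocrystal linearD !mxE tofracD. Qed.

Lemma to_isocrystal0 : to_isocrystal 0 = 0.
Proof. by apply/rowP => i; rewrite /to_isocrystal linear0 !mxE tofrac0. Qed.

Lemma to_isocrystal_phi u : to_isocrystal (phi u) = isocrystal (frob_mx phi) (to_isocrystal u).
Proof.
have uE : u = \sum_i v2r u 0 i *: r2v (delta_mx 0 i).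
  rewrite -[LHS]v2rK [X in r2v X]row_sum_delta linear_sum; apply: eq_bigr => i _.
  by rewrite linearZ.
rewrite [in LHS]uE; have -> : phi (\sum_i v2r u 0 i *: r2v (delta_mx 0 i)) =
    \sum_i sigma (v2r u 0 i) *: phi (r2v (delta_mx 0 i)).
  elim/big_rec2: _ => [|i y1 y2 _ <-]; first exact: semilin0.
  by rewrite semilinD // semilinZ.
apply/rowP => j; rewrite /to_isocrystal linear_sum !mxE summxE.
rewrite (big_morph _ (@tofracD _) (@tofrac0 _)); apply: eq_bigr => i _.
by rewrite linearZ !mxE tofracM frac_frob_tofrac.
Qed.

Lemma to_isocrystal_iter N u :
  to_isocrystal (iter N phi u) = iter N (isocrystal (frob_mx phi)) (to_isocrystal u).
Proof. exact: (iter_conj to_isocrystal_phi). Qed.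

(** Every denominator is a power of p times a unit. All larger exponents are allowed so that several
    coordinates can share one. *)
Lemma frac_pdenom (x : K0) : exists n, forall m, (n <= m)%N ->
  exists a : W, p%:R ^+ m * x = a%:F.
Proof.
rewrite (frac_repr x); have := denom_ratioP (repr x).
move: (frac (repr x)).1 (frac (repr x)).2 => a b /witt_decomp[n [d [-> ud]]].
exists n => m nm; exists (P ^+ (m - n) * a / d).
have dF : d%:F != 0 by rewrite tofrac_eq0; apply: contraTneq ud => ->; rewrite unitr0.
have pF : (P ^+ n)%:F != 0 by rewrite tofrac_eq0 witt_pX_neq0.
have mE : p%:R ^+ m = (P ^+ (m - n))%:F * (P ^+ n)%:F :> K0.
  by rewrite -tofracM -exprD subnK // pX_tofrac.
apply: (mulIf dF); rewrite -tofracM divrK // !tofracM mE.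
exact: mul_divK.
Qed.

Lemma lattice_multiple (v : 'rV[K0]_(dim M)) :
  exists n, exists u : M, p%:R ^+ n *: v = to_isocrystal u.
Proof.
have [n hn] := choice (fun i => frac_pdenom (v 0 i)).
have hm i : (n i <= \sum_j n j)%N by rewrite (bigD1 i) //= leq_addr.
have [a ha] := choice (fun i => hn i _ (hm i)).
exists (\sum_j n j)%N, (r2v (\row_i a i)).
by apply/rowP => i; rewrite !mxE r2vK mxE ha.
Qed.

Lemma lattice_eigen (v : 'rV[K0]_(dim M)) r s : v != 0 ->
  iter r (isocrystal (frob_mx phi)) v = p%:R ^+ s *: v ->
  exists n, exists u : M, [/\ p%:R ^+ n *: v = to_isocrystal u, u != 0 & iter r phi u = P ^+ s *: u].
Proof.
move=> v0 hv; have [n [u hu]] := lattice_multiple v; exists n, u; split=> //.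
  apply: contraNneq v0 => u0; move: hu; rewrite u0 to_isocrystal0 => /eqP.
  by rewrite scaler_eq0 -pX_tofrac tofrac_eq0 (negPf (witt_pX_neq0 hp n)).
apply: to_isocrystal_inj; rewrite to_isocrystal_iter -hu iter_isocrystalZ hv.
by rewrite to_isocrystalZ -hu pX_tofrac !scalerA mulrC.
Qed.

(** A basis vector of a simple summand of slope l is an eigenvector; it is carried back through the
    isomorphism and multiplied by a power of p to lie in M. *)
Lemma newton_slope_eigen l : newton_slope phi l ->
  0 <= l /\ exists2 u : M, u != 0 & iter `|denq l| phi u = P ^+ `|numq l| *: u.
Proof.
move=> [m [ls [[l0 [f [[g fK gK] fE]]] [i <-]]]]; split; first exact: l0.
have r0 : (0 < `|denq (ls i)|)%N by rewrite absz_gt0 denq_neq0.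
pose t := @tagnat.Rank m (fun i => `|denq (ls i)|%N) i (Ordinal r0).
have := mxdiag_eigen t; rewrite tagnat.Rank1K => ht.
pose v := g (delta_mx 0 t).
have [||n [u [_ u0 hu]]] := @lattice_eigen v `|denq (ls i)| `|numq (ls i)|; last by exists u.
  apply/eqP => v0; have := gK (delta_mx 0 t); rewrite -/v v0 linear0.
  by move/rowP/(_ t)/eqP; rewrite !mxE !eqxx eq_sym oner_eq0.
by apply: (can_inj fK); rewrite (iter_conj fE) /v gK ht linearZ gK.
Qed.

End Lattice.
End Newton.

Lemma rat_absz (l : rat) : 0 <= l -> l = `|numq l|%:R / `|denq l|%:R.
Proof.
move=> l0; rewrite -[LHS]divq_num_den -[in LHS](@gez0_abs (numq l)) ?numq_ge0 //.
by rewrite -[in LHS](@gez0_abs (denq l)) // ?denq_ge0 // -!pmulrn.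
Qed.

(** * Isoclinic crystals and the three cases *)

Section Main.
Variables (k : closedFieldType) (p : nat) (hp : p \in [pchar k]).
Local Notation W := (witt hp).
Local Notation K0 := {fraction witt hp}.
Local Notation P := (p%:R : W).

Lemma linear_inj_leq (m n : nat) (f : {linear 'rV[K0]_m -> 'rV[K0]_n}) :
  injective f -> (m <= n)%N.
Proof.
move=> fI; have : row_free (lin1_mx f).
  by apply: inj_row_free => v; rewrite mul_rV_lin1 -(linear0 f) => /fI.
by move=> /eqP <-; apply: rank_leq_col.
Qed.

(** If all summands have the same slope, all standard vectors are eigenvectors with the same
    eigenvalue. By dimension there are at least two, and clearing denominators keeps them
    independent. *)
Lemma isoclinic_independent (M : vectType W) (phi : M -> M) m (ls : 'I_m -> rat) l :
  semilinear_frob phi -> dim M = 2%N -> newton_decomposition phi ls -> (forall i, ls i = l) ->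
  exists u1 u2 : M, [/\ forall a b, a *: u1 + b *: u2 = 0 -> a = 0 /\ b = 0,
    iter `|denq l| phi u1 = P ^+ `|numq l| *: u1 & iter `|denq l| phi u2 = P ^+ `|numq l| *: u2].
Proof.
move=> sp dM [_ [f [[g fK gK] fE]]] lsl.
have n2 : (2 <= \sum_i `|denq (ls i)|)%N.
  by have := linear_inj_leq (can_inj fK); rewrite dM.
have gL : linear g by move=> a u v; apply: (can_inj fK); rewrite gK linearP !gK.
have key t : exists n, exists u : M, p%:R ^+ n *: g (delta_mx 0 t) = to_isocrystal u /\
    iter `|denq l| phi u = P ^+ `|numq l| *: u.
  have [||n [u [hu _ hu']]] := @lattice_eigen _ _ _ _ phi sp (g (delta_mx 0 t)) `|denq l| `|numq l|.
  - apply/eqP => v0; have := gK (delta_mx 0 t); rewrite v0 linear0.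
    by move/rowP/(_ t)/eqP; rewrite !mxE !eqxx eq_sym oner_eq0.
  - apply: (can_inj fK); rewrite (iter_conj fE) gK linearZ gK.
    by have := @mxdiag_eigen k p hp m ls t; rewrite /= lsl.
  - by exists n, u.
pose t0 := Ordinal (ltnW n2); pose t1 := Ordinal n2.
have [n0 [u0 [h0 E0]]] := key t0; have [n1 [u1 [h1 E1]]] := key t1.
exists u0, u1; split=> // a b.
move/(congr1 (@to_isocrystal _ _ _ M))/(congr1 f).
rewrite to_isocrystalD !to_isocrystalZ to_isocrystal0 linear0 -h0 -h1.
rewrite linearD !linearZ !gK => /rowP h.
have pn n : (p%:R ^+ n == 0 :> K0) = false.
  by rewrite -pX_tofrac tofrac_eq0 (negPf (witt_pX_neq0 hp n)).
split; [have := h t0 | have := h t1]; rewrite !mxE !eqxx /= !(mulr0, mulr1, add0r, addr0) => /eqP;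
  by rewrite mulf_eq0 tofrac_eq0 pn orbF => /eqP.
Qed.

End Main.

Theorem theorem1p4 (p : nat) (k : closedFieldType) (hp : p \in [pchar k])
    (M : vectType (witt hp)) (phi : M -> M) (e : nat) (lambda1 : rat) :
  fcrystal phi ->
  dim M = 2%N ->
  (0 < e)%N ->
  hodge_slopes phi [:: 0%N; e] ->
  smallest_newton_slope phi lambda1 ->
  [/\ sum_of_two_rank1 phi -> isomorphism_number phi 1,
      ~ sum_of_two_rank1 phi -> isoclinic phi -> isomorphism_number phi e &
      ~ sum_of_two_rank1 phi -> ~ isoclinic phi ->
        exists2 n : nat, isomorphism_number phi n & n%:R <= 2 * lambda1].
Proof.
move=> [_ sp ip] dM e0 hodge [slope1 _].
have [e1 [e2 [a [b [c [d ad]]]]]] := hodge_adapted sp ip dM e0 hodge.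
have nonsum : ~ sum_of_two_rank1 phi -> residue a = 0.
  move=> ns; apply: witt_nonunit; apply/negP => ua; apply: ns.
  have [x [y [hxy px py]]] := ordinary_form sp e0 ad ua.
  exact: sum_rank1_of_diag sp hxy px py.
have [_ ud _ _] := ad.
have cyc : residue a = 0 -> [/\ cyclic_unit a b c d \is a GRing.unit,
    cyclic_form phi ((p%:R : witt hp) ^+ e * cyclic_unit a b c d) (cyclic_beta e a c d) e1 &
    residue (cyclic_beta e a c d) = 0].
  move=> a0; split; [|exact: (adapted_cyclic sp ad a0)|exact: residue_cyclic_beta].
  exact: cyclic_unit_unit (adapted_nonordinary ad a0) ud.
(* The valuation of beta is compared with e / 2; w > 0 because beta has residue 0. *)
have dichotomy : residue a = 0 -> pdvd (uphalf e) (cyclic_beta e a c d) \/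
    exists w beta0, [/\ (0 < w)%N, (w.*2 < e)%N, beta0 \is a GRing.unit &
      cyclic_beta e a c d = (p%:R : witt hp) ^+ w * beta0].
  move=> /cyc[_ _ b0].
  have [bz|/witt_decomp[w [beta0 [bE ub]]]] := eqVneq (cyclic_beta e a c d) 0.
    by left; rewrite bz; exists 0; rewrite mulr0.
  have [we|we] := leqP (uphalf e) w.
    by left; apply: (pdvd_leq we); exists beta0.
  right; exists w, beta0; split=> //; last by lia.
  case: w bE {we} => // bE; case/witt_unitP: ub.
  by rewrite -b0 bE mul1r.
split=> [sum|/nonsum a0 [l [sl lu]]|/nonsum a0 niso].
- exact: ordinary_isomorphism_number sp e0 ad (sum_rank1_ordinary sp e0 ad sum).
- have [uu hx b0] := cyc a0.
  have [[beta0 bE]|[w [beta0 [w0 we ub bE]]]] := dichotomy a0.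
    exact: isoclinic_isomorphism_number sp e0 ad a0 bE.
  (* Isoclinicity would give two independent eigenvectors with the same eigenvalue, excluded when 2
     w < e. *)
  exfalso; have [m [ls [dec [i li]]]] := sl.
  have lsl j : ls j = l by apply/esym/lu; exists m, ls; split=> //; exists j.
  have [u1 [u2 [ind h1 h2]]] := isoclinic_independent sp dM dec lsl.
  apply: (nonisoclinic_eigen sp uu hx _ we ub bE ind h1 h2).
  by rewrite absz_gt0 denq_neq0.
have [uu hx b0] := cyc a0.
have [hb|[w [beta0 [w0 we ub bE]]]] := dichotomy a0.
  (* Here every Newton slope equals e / 2, so the crystal would be isoclinic. *)
  case: niso; suff slE l : newton_slope phi l -> l = e%:R / 2.
    by exists lambda1; split=> // l' /slE ->; rewrite (slE _ slope1).
  move=> /(newton_slope_eigen sp)[l0 [u u0 hu]].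
  have := isoclinic_eigen sp uu hx hb u0 hu.
  have r0 : (`|denq l|%:R : rat) != 0 by rewrite pnatr_eq0 absz_eq0 denq_neq0.
  move/(congr1 (fun n : nat => n%:R : rat)); rewrite -muln2 !natrM => hre.
  rewrite {1}(rat_absz l0); apply: (canLR (mulfK r0)).
  by rewrite mulrAC [e%:R * _]mulrC hre mulfK.
have [n hn le_n] := isomorphism_number_exists (nonisoclinic_isomorphism_bound sp ad a0 w0 we ub bE).
exists n => //; have [l0 [u u0 hu]] := newton_slope_eigen sp slope1.
have hw : pdvd w (cyclic_beta e a c d) by exists beta0.
have := eigen_slope_ge sp uu hx hw (ltnW we) u0 hu => hrw.
have r0 : (0 : rat) < `|denq lambda1|%:R by rewrite ltr0n absz_gt0 denq_neq0.
(* n <= 2 w, and r w <= s says that w <= s / r = lambda1. *)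
apply: (@le_trans _ _ (w.*2)%:R); first by rewrite ler_nat.
rewrite -muln2 natrM mulrC ler_pM2l // (rat_absz l0) ler_pdivlMr //.
by rewrite -natrM ler_nat mulnC.
Qed.
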